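(* Let $M$ be a manifold and let $F=\alpha\,\phi(\beta/\alpha)$ be a non-Riemannian (regular or singular) $(\alpha,\beta)$-metric on $M$ which is not of the metric type of any member of $$\Theta=\big\{\beta^m\alpha^{1-m}\ (m\neq 0,1),\ \ \beta e^{\alpha^2/\beta^2},\ \ \beta e^{-\alpha^2/\beta^2}\big\}.$$ Let $V$ be a vector field and $c$ a scalar function on $M$. Then $V$ is a conformal vector field of $F$ with conformal factor $c$ if and only if $$V^c(\alpha^2)=4c\,\alpha^2\quad\text{and}\quad V^c(\beta)=2c\,\beta .$$
   Context: An $(\alpha,\beta)$-metric on a manifold $M$ is a Finsler metric $F>0$ of the form $F=\alpha\phi(s)$, $s=\beta/\alpha$, where $\alpha=\sqrt{a_{ij}(x)y^iy^j}$ is a (positive definite) Riemannian metric, $\beta=b_i(x)y^i$ is a 1-form on $M$, and $\phi$ is a smooth function of one variable. A Finsler metric is regular if it is positive definite (its fundamental tensor $\frac12[F^2]_{y^iy^j}$ is positive definite) on the whole slit tangent bundle $TM\setminus 0$; otherwise it is singular. Singular metrics are allowed, in which case $F$ is considered on the open conic part of $TM\setminus 0$ where it is defined. Metric type: two $(\alpha,\beta)$-metrics $F$ and $\widetilde F$ are of the same metric type if they can be written as $F=\alpha\phi(\beta/\alpha)$, $\widetilde F=\widetilde\alpha\,\phi(\widetilde\beta/\widetilde\alpha)$ with the same function $\phi$, where $\widetilde\alpha=\sqrt{k_1\alpha^2+k_2\beta^2}$, $\widetilde\beta=k_3\beta$ and $k_1>0$, $k_2$, $k_3\neq 0$ are constants.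 Complete lift: for a vector field $V=V^i\partial/\partial x^i$ on $M$, $V^c:=V^i\frac{\partial}{\partial x^i}+y^i\frac{\partial V^j}{\partial x^i}\frac{\partial}{\partial y^j}$ is the complete lift of $V$ to $TM$ (the superscript $c$ is only notation, unrelated to the function $c$). Functions such as $\alpha^2$ and $\beta$ are regarded as functions on $TM$. Conformal vector field: let $\varphi_t$ be the flow of $V$ and $\widetilde\varphi_t(x,y)=(\varphi_t(x),\varphi_{t*}(y))$. $V$ is conformal for $F$ if $\widetilde\varphi_t^*F=e^{2\sigma_t}F$ with $\sigma_t$ a function on $M$ for every $t$; its conformal factor is $c=\frac{d}{dt}\big|_{t=0}\sigma_t$. Equivalently, $V$ is conformal with conformal factor $c=c(x)$ iff $V^c(F)=2cF$.
   Formalization: Assumes dim M ≥ 2; ''non-Riemannian'' (F² not a quadratic form, even indefinite) and ''not of a type in Θ'' are required also on every nonempty open set where β has no zero; the types of Θ with k_1<0 are excluded too. Without these the claim is false. *)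

(* Defs.v *)
From HB Require Import structures.
From mathcomp Require Import all_boot all_order all_algebra.
From mathcomp Require Import all_classical all_reals all_analysis.
Set Implicit Arguments.
Unset Strict Implicit.
Unset Printing Implicit Defensive.
Import Order.TTheory GRing.Theory Num.Theory.
Import numFieldNormedType.Exports.
Local Open Scope classical_set_scope.
Local Open Scope ring_scope.

Section Calculus.
Context {R : realType} {n : nat}.

Definition pderiv (k : 'I_n) (f : 'rV[R]_n -> R) (x : 'rV[R]_n) : R :=
  'D_(delta_mx ord0 k) f x.

Fixpoint Ck (m : nat) (U : set 'rV[R]_n) (f : 'rV[R]_n -> R) : Prop :=
  (forall x, U x -> {for x, continuous f}) /\
  match m with
  | 0%N => True
  | m'.+1 => forall k, (forall x, U x -> derivable f x (delta_mx ord0 k)) /\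
                       Ck m' U (pderiv k f)
  end.

Definition smooth_on (U : set 'rV[R]_n) (f : 'rV[R]_n -> R) : Prop :=
  forall m, Ck m U f.

Definition smooth1_on (I : set R) (f : R -> R) : Prop :=
  forall (m : nat) s, I s -> derivable (derive1n m f) s 1.

End Calculus.

(* Smooth n-manifolds, by an atlas on a topological space. [crd_inv i] is the
   inverse of the chart [crd i]; only its values on the open set
   [crd i @` cdom i] matter. *)
Record atlas (R : realType) (n : nat) (M : topologicalType) := Atlas {
  chart : Type;
  cdom : chart -> set M;
  crd : chart -> M -> 'rV[R]_n;
  crd_inv : chart -> 'rV[R]_n -> M;
  atlas_hausdorff : hausdorff_space M;
  atlas_second_countable : @second_countable M;
  cdom_open : forall i, open (cdom i);
  cdom_cover : forall p, exists i, cdom i p;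
  img_open : forall i, open (crd i @` cdom i);
  crdK : forall i p, cdom i p -> crd_inv i (crd i p) = p;
  crd_continuous : forall i p, cdom i p -> {for p, continuous (crd i)};
  crd_inv_continuous : forall i x, (crd i @` cdom i) x -> {for x, continuous (crd_inv i)};
  transition_smooth : forall i j (l : 'I_n),
    smooth_on (crd i @` (cdom i `&` cdom j)) (fun x => crd j (crd_inv i x) ord0 l)
}.

Section Tensors.
Context {R : realType} {n : nat} {M : topologicalType} (A : atlas R n M).

Definition img (i : chart A) : set 'rV[R]_n := crd i @` cdom i.
Definition overlap (i j : chart A) : set 'rV[R]_n := crd i @` (cdom i `&` cdom j).
Definition transition (i j : chart A) (x : 'rV[R]_n) : 'rV[R]_n := crd j (crd_inv i x).

(* Components are row vectors, so tangent vectors transform by y |-> y *m jac. *)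
Definition jac (i j : chart A) (x : 'rV[R]_n) : 'M[R]_n :=
  \matrix_(k, l) pderiv k (fun x' => transition i j x' ord0 l) x.

Record vector_field := VectorField {
  vf :> chart A -> 'rV[R]_n -> 'rV[R]_n;
  vf_smooth : forall i l, smooth_on (img i) (fun x => vf i x ord0 l);
  vf_trans : forall i j x, overlap i j x ->
    vf j (transition i j x) = vf i x *m jac i j x
}.

Record one_form := OneForm {
  of_ :> chart A -> 'rV[R]_n -> 'rV[R]_n;
  of_smooth : forall i l, smooth_on (img i) (fun x => of_ i x ord0 l);
  of_trans : forall i j x, overlap i j x ->
    of_ i x = of_ j (transition i j x) *m (jac i j x)^T
}.

Record riemannian_metric := RiemannianMetric {
  rm :> chart A -> 'rV[R]_n -> 'M[R]_n;
  rm_smooth : forall i k l, smooth_on (img i) (fun x => rm i x k l);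
  rm_sym : forall i x, img i x -> (rm i x)^T = rm i x;
  rm_pos : forall i x (y : 'rV[R]_n), img i x -> y != 0 ->
    0 < (y *m rm i x *m y^T) ord0 ord0;
  rm_trans : forall i j x, overlap i j x ->
    rm i x = jac i j x *m rm j (transition i j x) *m (jac i j x)^T
}.

(* Functions on (an open part of) TM, read in the induced coordinates (x, y). *)
Definition tfun := chart A -> 'rV[R]_n -> 'rV[R]_n -> R.

Definition complete_lift (V : vector_field) (f : tfun) : tfun := fun i x y =>
  \sum_k V i x ord0 k * pderiv k (fun x' => f i x' y) x +
  \sum_k \sum_l y ord0 k * pderiv k (fun x' => V i x' ord0 l) x *
                pderiv l (f i x) y.

Definition alpha2 (a : riemannian_metric) : tfun := fun i x y =>
  (y *m a i x *m y^T) ord0 ord0.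
Definition alpha (a : riemannian_metric) : tfun := fun i x y =>
  Num.sqrt (alpha2 a i x y).
Definition beta (b : one_form) : tfun := fun i x y =>
  \sum_k b i x ord0 k * y ord0 k.

Definition ab_fun (a : riemannian_metric) (b : one_form) (phi : R -> R) : tfun :=
  fun i x y => alpha a i x y * phi (beta b i x y / alpha a i x y).

(* The open conic part of TM \ 0 where F = alpha phi(beta/alpha) is defined,
   I being the domain of phi. *)
Definition conic_dom (a : riemannian_metric) (b : one_form) (I : set R)
    (i : chart A) (x y : 'rV[R]_n) : Prop :=
  [/\ img i x, y != 0 & I (beta b i x y / alpha a i x y)].

Definition fundamental_tensor (F : tfun) (i : chart A) (x y : 'rV[R]_n) : 'M[R]_n :=
  \matrix_(k, l) (2^-1 * pderiv k (pderiv l (fun y' => F i x y' ^+ 2)) y).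

(* Regular or singular metrics. Without some nondegeneracy of the fundamental
   tensor, F = beta (phi(s) = s) would be included; one nondegenerate direction
   over each point is all that is required. *)
Record ab_metric := ABMetric {
  ab_a : riemannian_metric;
  ab_b : one_form;
  ab_phi : R -> R;
  ab_dom : set R;
  ab_dom_open : open ab_dom;
  ab_dom_interval : is_interval ab_dom;
  ab_phi_smooth : smooth1_on ab_dom ab_phi;
  ab_pos : forall i x y, conic_dom ab_a ab_b ab_dom i x y ->
    0 < ab_fun ab_a ab_b ab_phi i x y;
  ab_nondeg : forall i x, img i x -> exists2 y,
    conic_dom ab_a ab_b ab_dom i x y &
    fundamental_tensor (ab_fun ab_a ab_b ab_phi) i x y \in unitmx
}.

Definition ab_F (F : ab_metric) : tfun := ab_fun (ab_a F) (ab_b F) (ab_phi F).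
Definition ab_conic (F : ab_metric) :=
  conic_dom (ab_a F) (ab_b F) (ab_dom F).

Definition conformal_with (V : vector_field) (c : M -> R) (F : ab_metric) : Prop :=
  forall i x y, ab_conic F i x y ->
    complete_lift V (ab_F F) i x y = 2 * c (crd_inv i x) * ab_F F i x y.

(* F^2 is quadratic in y over U; a singular F may give an indefinite form. *)
Definition riemannian_on (F : ab_metric) (U : set M) : Prop :=
  forall i x, img i x -> U (crd_inv i x) -> exists g : 'M[R]_n,
    forall y, ab_conic F i x y ->
      ab_F F i x y ^+ 2 = (y *m g *m y^T) ord0 ord0.

(* Over U, F = alpha' psi(beta'/alpha') with
   alpha' = sqrt(k1 alpha^2 + k2 beta^2) and beta' = k3 beta. *)
Definition rewritten_on (F : ab_metric) (psi : R -> R) (k1 k2 k3 : R)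
    (U : set M) : Prop :=
  forall i x y, ab_conic F i x y -> U (crd_inv i x) ->
    let q := k1 * alpha2 (ab_a F) i x y + k2 * beta (ab_b F) i x y ^+ 2 in
    let be := k3 * beta (ab_b F) i x y in
    [/\ 0 < q, 0 < be & ab_F F i x y = Num.sqrt q * psi (be / Num.sqrt q)].

Definition metric_type_on (F : ab_metric) (psi : R -> R) (U : set M) : Prop :=
  exists k1 k2 k3 : R,
    [/\ 0 < k1, k3 != 0 & rewritten_on F psi k1 k2 k3 U].

(* The same with k1 < 0, i.e. with alpha'^2 of Lorentzian signature. *)
Definition lorentz_type_on (F : ab_metric) (psi : R -> R) (U : set M) : Prop :=
  exists k1 k2 k3 : R,
    [/\ k1 < 0, k3 != 0 & rewritten_on F psi k1 k2 k3 U].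

(* The functions psi with alpha psi(beta/alpha) in Theta. *)
Definition Theta : set (R -> R) := [set psi |
  [\/ exists m : R, [/\ m != 0, m != 1 & psi = fun s => s `^ m],
      psi = (fun s => s * expR (s ^- 2)) |
      psi = (fun s => s * expR (- s ^- 2))]].

(* P fails on M, and it fails locally wherever beta has no zero. The global
   condition alone is too weak because phi need not be analytic: F may satisfy P
   over a part of M where |beta/alpha| stays small, and not elsewhere. *)
Definition nowhere (F : ab_metric) (P : set M -> Prop) : Prop :=
  ~ P setT /\
  forall U : set M, open U -> U !=set0 ->
    (forall i x, img i x -> U (crd_inv i x) -> ab_b F i x != 0) -> ~ P U.

End Tensors.

(* Main.v *)
Require Import Defs.
From mathcomp Require Import all_boot all_order all_algebra.
From mathcomp Require Import all_classical all_reals all_analysis.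
From mathcomp Require Import ring lra.
Set Implicit Arguments.
Unset Strict Implicit.
Unset Printing Implicit Defensive.
Import Order.TTheory GRing.Theory Num.Theory.
Import numFieldNormedType.Exports.
Local Open Scope classical_set_scope.
Local Open Scope ring_scope.

(** Fix a point x of a chart and write al^2, be for alpha^2, beta at x, and
s = be/al.  The complete lift is a derivation, P = V^c(alpha^2) is a quadratic
form in y and Q = V^c(beta) a linear one.  By the chain rule, with
P' = P - 4c al^2 and Q' = Q - 2c be, the condition V^c(F) = 2cF becomes

  P'(y) (phi(s) - s phi'(s)) + 2 al phi'(s) Q'(y) = 0         (E)

for all y in the conic domain ([conformal_residualE]), and the claim is that (E)
forces P' = 0 and Q' = 0; the converse is immediate.

Suppose first that be is nonzero at x, with dual norm N = |be|^2.  In the plane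
spanned by the vector b# dual to be and some e with be(e) = 0, the two unit
vectors with be = s are mirror images under e -> -e.  The half-sum and the
half-difference of (E) at these vectors are linear equations

  (k s^2 + l) phi = s (k s^2 + d) phi',      u s phi = (u s^2 - v) phi'

with constant coefficients, valid for every s in the domain of phi with
s^2 <= N.  If all coefficients vanish for all e, then P' = Q' = 0.  Otherwise
phi is explicit on this range ([exceptional_of_even_equation],
[quadratic_of_odd_equation]): phi^2 = C1 s^2 + C2, which makes F^2 a quadratic
form; or phi is, up to constants, |s|^m |k s^2 + d|^((1-m)/2), which is the
metric type of s^m in its Riemannian variant when d and k s^2 + d have the same
sign, and in its Lorentzian variant otherwise; or phi is, up to constants,
s exp(1/s^2) or s exp(-1/s^2).

To contradict the hypotheses, such a formula is needed over an open set with the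
same constants.  The points with be <> 0 where (P', Q') <> 0 form an open set
([residual_neighborhood]).  The range s^2 <= N grows with N, so a formula valid
at a point x2 is valid at every point where N is not larger; and a continuous
function N on an open set always satisfies N <= N(x2) on a nonempty open
subset, for a suitable x2 ([locally_near_maximum]).

Finally let be = 0 at x.  Then s = 0 for all y, and comparing (E) at y and at -y
gives P' = 0.  The function 2 al^2 Q - P be does not involve c, is continuous,
and vanishes at the points with be <> 0; it also vanishes wherever be is zero
nearby.  Hence it vanishes at x, so Q = Q' = 0 there
([residual_free_of_neq0]). *)

(** * Profiles phi satisfying the even or the odd equation *)

Section OnIntervals.
Context {R : realType} {K : set R} (K_itv : is_interval K).

Lemma constant_on_interval (f : R -> R) :
  (forall s, K s -> is_derive s 1 f 0) ->
  forall s t, K s -> K t -> f s = f t.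
Proof.
move=> df.
suff lt s t : K s -> K t -> s < t -> f s = f t.
  move=> s t Ks Kt; case: (ltgtP s t) => [st|ts|->//]; first exact: lt.
  by rewrite (lt t s).
move=> Ks Kt st.
have inK u : u \in `[s, t] -> K u.
  by rewrite in_itv /= => /andP[su ut]; apply: (K_itv Ks Kt); rewrite su ut.
have [||u _] := @MVT R f (cst 0) s t st.
- by move=> u /subset_itv_oo_cc /inK /df.
- apply: derivable_within_continuous => u /inK /df Du.
  exact: ex_derive.
by rewrite /cst mul0r => /eqP; rewrite subr_eq0 eq_sym => /eqP.
Qed.

Lemma constant_sign_on_interval (f : R -> R) :
  continuous f -> (forall s, K s -> f s != 0) ->
  forall s t, K s -> K t -> 0 < f s -> 0 < f t.
Proof.
move=> cf fn0 s t Ks Kt fs0; rewrite ltNge; apply/negP => ft0.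
have inK u : u \in `[Num.min s t, Num.max s t] -> K u.
  rewrite in_itv /=; case: (leP s t) => _ /andP[su ut].
    by apply: (K_itv Ks Kt); rewrite su ut.
  by apply: (K_itv Kt Ks); rewrite su ut.
have mM : Num.min s t <= Num.max s t by rewrite ge_min le_max lexx.
have cw : {within `[Num.min s t, Num.max s t], continuous f}.
  exact: continuous_subspaceT.
have [|u uI fu0] := @IVT R f _ _ 0 mM cw; last first.
  by move: (fn0 u (inK u uI)); rewrite fu0 eqxx.
by case: (leP s t) => _; rewrite ge_min le_max ft0 (ltW fs0) ?orbT.
Qed.

Lemma sign_on_interval (f : R -> R) :
  continuous f -> K !=set0 -> (forall s, K s -> f s != 0) ->
  exists sg, sg ^+ 2 = 1 /\ forall s, K s -> 0 < sg * f s.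
Proof.
move=> cf [s0 Ks0] fn0; have fs0 := fn0 s0 Ks0.
exists (Num.sg (f s0)); split; first by rewrite sqr_sg fs0.
move=> s Ks.
apply: (@constant_sign_on_interval (fun s => Num.sg (f s0) * f s) _ _ s0) => //.
- by move=> t; apply: cvgM; [exact: cvg_cst|exact: cf].
- by move=> t Kt; rewrite mulf_neq0 ?sgr_eq0 // fn0.
- by rewrite -normrEsg normr_gt0.
Qed.

End OnIntervals.

Section ProfileEquations.
Context {R : realType} (I : set R) (phi dphi : R -> R) (N : R).
Hypothesis I_open : open I.
Hypothesis I_itv : is_interval I.
Hypothesis phiD : forall s, I s -> is_derive s 1 phi (dphi s).
Hypothesis dphi_cont : forall s, I s -> {for s, continuous dphi}.
Hypothesis N_gt0 : 0 < N.

(** The values of beta/alpha over a point with |beta|^2 = N that lie in the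
domain I of phi. *)
Definition svalues : set R := [set s | I s /\ s ^+ 2 <= N].

Hypothesis phi_gt0 : forall s, svalues s -> 0 < phi s.
Hypothesis svalues_neq0 : svalues !=set0.

Lemma sqr_le_itv : is_interval [set s : R | s ^+ 2 <= N].
Proof.
move=> s t /= s2 t2 u /andP[su ut].
by have [u0|u0] := leP 0 u; nra.
Qed.

Lemma svalues_itv : is_interval svalues.
Proof.
move=> s t [Is s2] [It t2] u sut; split; first exact: I_itv Is It _ sut.
exact: sqr_le_itv s2 t2 _ sut.
Qed.

(** The coefficient k t^2 + d vanishes at no more than one value of t^2, so
it can be cancelled near any point of the range and, by continuity, at all of
them.  The boundary s^2 = N and the zeros of the coefficients of the equations
below are treated in this way. *)
Lemma vanish_from_interior (k d : R) (h : R -> R) :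
  (k != 0) || (d != 0) ->
  (forall s, I s -> {for s, continuous h}) ->
  (forall s, I s -> s ^+ 2 < N -> (k * s ^+ 2 + d) * h s = 0) ->
  forall s, svalues s -> h s = 0.
Proof.
move=> kd hc h0 s [Is s2]; apply: contrapT => /eqP hs0.
have nearI : \forall t \near s, I t by exact: open_nbhs_nbhs.
have nearh : \forall t \near s, h t != 0.
  have : h t @[t --> s] --> h s by exact: hc.
  by move=> /(_ _ (open_nbhs_nbhs (conj (@open_neq R 0) hs0))).
have /nbhs_ballP[e /= e0 be] : \forall t \near s, I t /\ h t != 0.
  by near=> t; split; near: t.
have key t : `|s - t| < e -> t ^+ 2 < N -> k * t ^+ 2 + d = 0.
  move=> st t2; have [It ht] := be t st.
  by have /eqP := h0 t It t2; rewrite mulf_eq0 (negbTE ht) orbF => /eqP.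
suff [t1 [t2 [b1 l1 b2 l2 ne]]] : exists t1 t2, [/\ `|s - t1| < e, t1 ^+ 2 < N,
    `|s - t2| < e, t2 ^+ 2 < N & t1 ^+ 2 - t2 ^+ 2 != 0].
  have e1 := key _ b1 l1; have e2 := key _ b2 l2.
  have : k * (t1 ^+ 2 - t2 ^+ 2) = 0 by rewrite mulrBr; lra.
  move/eqP; rewrite mulf_eq0 (negbTE ne) orbF => /eqP k0.
  by move: kd e1; rewrite k0 eqxx mul0r add0r /= => /eqP.
have [s0|s0] := eqVneq s 0.
  pose r := Num.min e (Num.min 1 N).
  have r0 : 0 < r by rewrite !lt_min e0 ltr01.
  have re : r <= e by rewrite ge_min lexx.
  have r1 : r <= 1 by rewrite !ge_min lexx orbT.
  have rN : r <= N by rewrite !ge_min lexx !orbT.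
  exists (r / 2), (r / 4); rewrite s0 !sub0r !normrN !gtr0_norm; try lra.
  have r2 : 0 < r ^+ 2 <= N by nra.
  by split; rewrite ?exprMn; try lra; apply: lt0r_neq0; rewrite ?exprMn; lra.
have as0 : 0 < `|s| by rewrite normr_gt0.
pose r := Num.min (e / `|s|) 1.
have r0 : 0 < r by rewrite !lt_min divr_gt0 // ltr01.
have re : r * `|s| <= e by rewrite -ler_pdivlMr // ge_min lexx.
have r1 : r <= 1 by rewrite !ge_min lexx orbT.
have s20 : 0 < s ^+ 2 by rewrite exprn_even_gt0.
exists ((1 - r / 2) * s), ((1 - r / 4) * s).
have -> : s - (1 - r / 2) * s = r * s / 2 by lra.
have -> : s - (1 - r / 4) * s = r * s / 4 by lra.
rewrite !normrM !(gtr0_norm r0) !(@gtr0_norm _ (_^-1)); try lra.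
rewrite !exprMn.
have B : 0 < r * `|s| by rewrite mulr_gt0.
split; try lra; try nra.
Unshelve. all: by end_near. Qed.

Lemma is_derive_quadr (k d s : R) :
  is_derive s 1 (fun t : R => k * t ^+ 2 + d) (2 * k * s).
Proof.
have -> : (fun t : R => k * t ^+ 2 + d) = (cst k * (id ^+ 2) + cst d)%R.
  by apply/funext => t /=; rewrite !fctE.
by apply: is_derive_eq; rewrite /GRing.scale /= /cst; ring.
Qed.

Lemma continuous_quadr (k d : R) : continuous (fun t : R => k * t ^+ 2 + d).
Proof.
move=> s; apply: differentiable_continuous; apply/derivable1_diffP.
by have [] := is_derive_quadr k d s.
Qed.

Lemma phi_continuous s : I s -> {for s, continuous phi}.
Proof.
move=> /phiD[dp _]; apply: differentiable_continuous.
exact/derivable1_diffP.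
Qed.

(** The coefficient w = u s^2 - v has no zero on the range, and then
phi^2 / w has derivative 0.  At a zero of w, phi > 0 gives u s = 0, which is
possible only for v = 0 and s = 0. *)
Lemma quadratic_of_odd_equation (u v : R) :
  (u != 0) || (v != 0) ->
  (forall s, svalues s -> u * s * phi s = (u * s ^+ 2 - v) * dphi s) ->
  exists C1 C2, forall s, svalues s -> phi s ^+ 2 = C1 * s ^+ 2 + C2.
Proof.
move=> uv ode.
have w0 s : svalues s -> u * s ^+ 2 - v != 0.
  move=> Js; apply/eqP => ws0; have ph0 := phi_gt0 Js.
  have us0 : u * s = 0.
    have /eqP := ode s Js; rewrite ws0 mul0r mulf_eq0 (gt_eqF ph0) orbF.
    by move/eqP.
  have v0 : v = 0.
    have : u * s ^+ 2 = 0 by rewrite expr2 mulrA us0 mul0r.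
    by lra.
  move: uv; rewrite v0 eqxx orbF => u0.
  have s0 : s = 0 by move/eqP: us0; rewrite mulf_eq0 (negbTE u0) => /eqP.
  (* Away from 0 the equation reads phi = s phi', so phi 0 = 0 by continuity *)
  have : phi s - s * dphi s = 0.
    apply: (@vanish_from_interior u 0 (fun t => phi t - t * dphi t)) =>
      [|t It|t It t2|//].
    - by rewrite u0.
    - apply: cvgB; first exact: phi_continuous.
      by apply: cvgM; [exact: cvg_id|exact: dphi_cont].
    - have := ode t (conj It (ltW t2)); rewrite v0 subr0 => odet.
      have -> : (u * t ^+ 2 + 0) * (phi t - t * dphi t) =
        t * (u * t * phi t - u * t ^+ 2 * dphi t) by ring.
      by rewrite odet subrr mulr0.
  by rewrite s0 mul0r subr0 -s0; lra.
have [s0 Js0] := svalues_neq0.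
pose f s := phi s ^+ 2 / (u * s ^+ 2 - v).
exists (f s0 * u), (- (f s0 * v)) => s Js.
have -> : f s0 = f s.
  apply: (constant_on_interval svalues_itv _ Js0 Js) => t Jt.
  have D1 := phiD Jt.1.
  have D2 := is_derive_quadr u (- v) t.
  have D3 := @is_deriveV R (fun t => u * t ^+ 2 - v) t _ 1 (w0 t Jt) D2.
  apply: (@is_derive_eq _ _ _ ((phi ^+ 2)%R * (fun t => (u * t ^+ 2 - v)^-1))%R).
  rewrite /GRing.scale /= !fctE /=.
  have := w0 t Jt; have := ode t Jt; set w := _ - v => od wt.
  have -> : 2 * u * t = 2 * (u * t) by ring.
  have -> : u * t = w * dphi t / phi t by rewrite -od mulfK // gt_eqF // phi_gt0.
  have pt : phi t != 0 by rewrite gt_eqF // phi_gt0.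
  by field; rewrite wt pt.
rewrite /f; field; exact: w0.
Qed.


(** Every positive solution of a first order linear homogeneous equation is
a multiple of the exponential of a primitive. *)
Lemma solution_of_log_derivative (G : R -> R) :
  (forall s, svalues s -> is_derive s 1 G (dphi s / phi s)) ->
  exists C, 0 < C /\ forall s, svalues s -> phi s = C * expR (G s).
Proof.
move=> DG; have [s0 Js0] := svalues_neq0.
pose f s := phi s * expR (- G s).
exists (f s0); split; first by rewrite mulr_gt0 ?expR_gt0 // phi_gt0.
move=> s Js; have -> : f s0 = f s; last by rewrite /f -mulrA -expRD addNr expR0 mulr1.
apply: (constant_on_interval svalues_itv _ Js0 Js) => t Jt.
have D1 := phiD Jt.1; have D2 := DG t Jt.
have DN : is_derive t 1 (fun t => - G t) (- (dphi t / phi t)).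
  exact: is_deriveN.
have D3 := @is_derive1_comp R expR (fun t => - G t) t _ _ (is_derive_expR _) DN.
apply: (@is_derive_eq _ _ _ (phi * (expR \o (fun t => - G t)))%R).
rewrite /GRing.scale /= ; have pt : phi t != 0 by rewrite gt_eqF // phi_gt0.
by field.
Qed.

(** The relation phi = sqrt q * psi(k3 s / sqrt q) is alpha' psi(beta'/alpha')
after division by alpha, so it says that F is of the metric type of psi, in the
Riemannian (k1 > 0) or Lorentzian (k1 < 0) sense. *)
Definition profile_of_type (psi : R -> R) (k1 k2 k3 : R) := forall s, svalues s ->
  let q := k1 + k2 * s ^+ 2 in
  [/\ 0 < q, 0 < k3 * s & phi s = Num.sqrt q * psi (k3 * s / Num.sqrt q)].

Lemma is_derive_ln_comp (f : R -> R) (x df : R) :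
  0 < f x -> is_derive x 1 f df -> is_derive x 1 (fun t => ln (f t)) (df / f x).
Proof.
move=> fx0 Df.
by have := is_derive1_comp (is_derive1_ln fx0) Df; rewrite mulrC.
Qed.

Lemma sqrt_expR_ln (q : R) : 0 < q -> Num.sqrt q = expR (ln q / 2).
Proof.
move=> q0; rewrite -[in LHS](lnK q0) [in LHS](_ : ln q = ln q / 2 *+ 2).
  by rewrite -mulr_natl expRM_natl sqrtr_sqr ger0_norm // expR_ge0.
by rewrite mulr2n; lra.
Qed.

Lemma powR_expR_ln (t m : R) : 0 < t -> t `^ m = expR (m * ln t).
Proof. by move=> t0; rewrite /powR gt_eqF. Qed.

(** The logarithmic derivative of phi is m/s + (1-m) k s/(k s^2 + d), whence
phi = C |s|^m |k s^2 + d|^((1-m)/2).  The signs of s and of k s^2 + d are constant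
on the range, and C is absorbed in k3 because m <> 0. *)
Lemma power_solution (k d m : R) :
  d != 0 -> m != 0 -> (forall s, svalues s -> s != 0) ->
  (forall s, svalues s -> k * s ^+ 2 + d != 0) ->
  (forall s, svalues s ->
     (k * s ^+ 2 + m * d) * phi s = s * (k * s ^+ 2 + d) * dphi s) ->
  exists k1 k2 k3, [/\ k1 != 0, k3 != 0 & profile_of_type (fun s => s `^ m) k1 k2 k3].
Proof.
move=> d0 m0 s0 w0 ode.
have idc : continuous (fun s : R => s) by move=> s; exact: cvg_id.
have [sg [sg1 sgP]] := sign_on_interval svalues_itv idc svalues_neq0 s0.
have [ta [ta1 taP]] :=
  sign_on_interval svalues_itv (@continuous_quadr k d) svalues_neq0 w0.
have sgn0 : sg != 0 by apply/eqP => h; move: sg1; rewrite h; lra.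
have tan0 : ta != 0 by apply/eqP => h; move: ta1; rewrite h; lra.
pose G s := m * ln (sg * s) + (1 - m) / 2 * ln (ta * (k * s ^+ 2 + d)).
have [|C [C0 phiE]] := @solution_of_log_derivative G.
  move=> s Js.
  have D1 : is_derive s 1 (fun s : R => sg * s) sg.
    apply: (@is_derive_eq _ _ _ (cst sg * id)%R).
    by rewrite /GRing.scale /= /cst; ring.
  have D2 : is_derive s 1 (fun s : R => ta * (k * s ^+ 2 + d)) (ta * (2 * k * s)).
    have D := is_derive_quadr k d s.
    apply: (@is_derive_eq _ _ _ (cst ta * (fun s : R => (k * s ^+ 2 + d)))%R).
    by rewrite /GRing.scale /= /cst; ring.
  have L1 := @is_derive_ln_comp (fun s => sg * s) s _ (sgP s Js) D1.
  have L2 := @is_derive_ln_comp (fun s => ta * (k * s ^+ 2 + d)) s _ (taP s Js) D2.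
  have -> : G = (cst m * (fun s => ln (sg * s)) +
    cst ((1 - m) / 2) * (fun s => ln (ta * (k * s ^+ 2 + d))))%R.
    by apply/funext => t; rewrite !fctE.
  have [LDe LDv] := is_deriveD (is_deriveM (is_derive_cst m s 1) L1)
    (is_deriveM (is_derive_cst ((1 - m) / 2) s 1) L2).
  apply: (DeriveDef LDe); rewrite LDv /GRing.scale.
  rewrite /= /cst.
  have pt : phi s != 0 by rewrite gt_eqF // phi_gt0.
  have sn0 := s0 s Js; have wn0 := w0 s Js.
  have -> : dphi s = (k * s ^+ 2 + m * d) * phi s / (s * (k * s ^+ 2 + d)).
    by rewrite ode // [RHS]mulrC mulKf // mulf_neq0.
  by field; rewrite sgn0 sn0 wn0 tan0 pt.
(* c3 = C^(1/m), so that c3^m absorbs C. *)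
pose c3 := expR (ln C / m).
exists (ta * d), (ta * k), (c3 * sg); split; first exact: mulf_neq0.
  by rewrite mulf_neq0 // gt_eqF // expR_gt0.
move=> s Js /=.
have -> : ta * d + ta * k * s ^+ 2 = ta * (k * s ^+ 2 + d) by ring.
have q0 := taP s Js; set q := ta * _ in q0 *.
have ss0 := sgP s Js; have c30 : 0 < c3 by exact: expR_gt0.
split => //; first by rewrite -mulrA mulr_gt0.
rewrite phiE // -[c3 * sg * s]mulrA /G -/q (sqrt_expR_ln q0).
rewrite powR_expR_ln; last first.
  by apply: divr_gt0; [exact: mulr_gt0|exact: expR_gt0].
have cs0 : 0 < c3 * (sg * s) by exact: mulr_gt0.
rewrite (ln_div cs0 (expR_gt0 _)) (lnM c30 ss0) expRK.
rewrite -[in LHS](lnK C0) -!expRD; congr expR.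
by rewrite /c3 expRK; field.
Qed.

(** The logarithmic derivative of phi is 1/s + (l/k)/s^3, whence
phi = C |s| exp(-(l/2k)/s^2).  The size of l/2k is absorbed in k1, and its sign
selects one of the two exponential members of Theta. *)
Lemma exp_solution (k l : R) :
  k != 0 -> l != 0 -> (forall s, svalues s -> s != 0) ->
  (forall s, svalues s ->
     (k * s ^+ 2 + l) * phi s = s * (k * s ^+ 2) * dphi s) ->
  exists psi k1 k2 k3, [/\ Theta psi, 0 < k1, k3 != 0 & profile_of_type psi k1 k2 k3].
Proof.
move=> k0 l0 s0 ode.
have idc : continuous (fun s : R => s) by move=> s; exact: cvg_id.
have [sg [sg1 sgP]] := sign_on_interval svalues_itv idc svalues_neq0 s0.
have sgn0 : sg != 0 by apply/eqP => h; move: sg1; rewrite h; lra.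
pose kap := - (l / (2 * k)).
have kap0 : kap != 0 by rewrite oppr_eq0 mulf_neq0 // invr_eq0 mulf_neq0.
pose G s := ln (sg * s) + kap * (s ^+ 2)^-1.
have [|C [C0 phiE]] := @solution_of_log_derivative G.
  move=> s Js; have sn0 := s0 s Js.
  have D1 : is_derive s 1 (fun s : R => sg * s) sg.
    apply: (@is_derive_eq _ _ _ (cst sg * id)%R).
    by rewrite /GRing.scale /= /cst; ring.
  have D2 : is_derive s 1 (fun s : R => s ^+ 2) (2 * s).
    have -> : (fun s : R => s ^+ 2) = (id ^+ 2)%R by apply/funext => t; rewrite fctE.
    by apply: is_derive_eq; rewrite /GRing.scale /=; ring.
  have L1 := @is_derive_ln_comp (fun s => sg * s) s _ (sgP s Js) D1.
  have s2 : s ^+ 2 != 0 by rewrite expf_neq0.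
  have L2 := @is_deriveV R (fun s => s ^+ 2) s _ 1 s2 D2.
  have -> : G = ((fun s => ln (sg * s)) + cst kap * (fun s => (s ^+ 2)^-1))%R.
    by apply/funext => t; rewrite !fctE.
  have [LDe LDv] := is_deriveD L1 (is_deriveM (is_derive_cst kap s 1) L2).
  apply: (DeriveDef LDe); rewrite LDv /GRing.scale.
  rewrite /= /cst.
  have pt : phi s != 0 by rewrite gt_eqF // phi_gt0.
  have -> : dphi s = (k * s ^+ 2 + l) * phi s / (s * (k * s ^+ 2)).
    by rewrite ode // [RHS]mulrC mulKf // !mulf_neq0.
  by rewrite /kap; field; rewrite sgn0 sn0 k0 pt.
pose k1 := `|kap| * C ^+ 2.
have k10 : 0 < k1 by rewrite mulr_gt0 ?normr_gt0 ?exprn_gt0.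
pose e := Num.sg kap.
exists (fun s => s * expR (e * s ^- 2)), k1, 0, (C * sg); split => //.
- rewrite /e; case: (ltgtP kap 0) kap0 => [kn _|kp _|//].
    by rewrite (ltr0_sg kn); apply: Or33; apply/funext => s; rewrite mulN1r.
  by rewrite (gtr0_sg kp); apply: Or32; apply/funext => s; rewrite mul1r.
- by rewrite mulf_neq0 // gt_eqF.
move=> s Js /=; rewrite mul0r addr0; split=> //.
  by rewrite -mulrA mulr_gt0 // sgP.
have sq0 : 0 < Num.sqrt k1 by rewrite sqrtr_gt0.
have ss := sqr_sqrtr (ltW k10).
have -> : e * (C * sg * s / Num.sqrt k1) ^- 2 = kap * (s ^+ 2)^-1.
  rewrite !exprMn exprVn ss sg1 [kap]numEsg -/e /k1.
  have C0' : C != 0 by rewrite gt_eqF.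
  by have sn0 := s0 s Js; field; rewrite sn0 C0' normr_eq0.
rewrite phiE // /G expRD lnK ?posrE ?sgP //.
by field; rewrite gt_eqF.
Qed.

(** The forms of phi that the hypotheses on F exclude; the sign of k1 tells the
Riemannian metric type from the Lorentzian one. *)
Definition exceptional_profile :=
  (exists C1 C2, forall s, svalues s -> phi s ^+ 2 = C1 * s ^+ 2 + C2) \/
  exists psi k1 k2 k3, [/\ Theta psi, k1 != 0, k3 != 0 & profile_of_type psi k1 k2 k3].

(** The odd equation holds up to a quadratic factor, or only in the interior
of the range, in the situations where it is used. *)
Lemma quadratic_of_weighted_odd_equation (k d u v : R) :
  (k != 0) || (d != 0) -> (u != 0) || (v != 0) ->
  (forall s, I s -> s ^+ 2 < N -> (k * s ^+ 2 + d) *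
     (u * s * phi s - (u * s ^+ 2 - v) * dphi s) = 0) ->
  exists C1 C2, forall s, svalues s -> phi s ^+ 2 = C1 * s ^+ 2 + C2.
Proof.
move=> kd uv ode; apply: (@quadratic_of_odd_equation u v uv) => s Js.
apply/eqP; rewrite -subr_eq0; apply/eqP.
apply: (@vanish_from_interior k d
  (fun s => u * s * phi s - (u * s ^+ 2 - v) * dphi s)) => // t It.
apply: cvgB.
  apply: cvgM; last exact: phi_continuous.
  by apply: cvgM; [exact: cvg_cst|exact: cvg_id].
by apply: cvgM; [exact: (@continuous_quadr u (- v))|exact: dphi_cont].
Qed.

(** With m = l/d the equation has the solution of [power_solution] when
d <> 0, and that of [exp_solution] when d = 0.  The values l = 0 and m = 1 are
special: a factor s, respectively k s^2 + d, splits off and leaves an odd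
equation.  For l <> 0 the value s = 0 is outside the range. *)
Lemma exceptional_of_even_equation (k l d : R) :
  [|| k != 0, l != 0 | d != 0] ->
  (forall s, svalues s ->
     (k * s ^+ 2 + l) * phi s = s * (k * s ^+ 2 + d) * dphi s) ->
  exceptional_profile.
Proof.
move=> kld ode.
have [l0|l0] := eqVneq l 0.
  left; apply: (@quadratic_of_weighted_odd_equation 1 0 k (- d)).
  - by rewrite oner_neq0.
  - by move: kld; rewrite l0 eqxx oppr_eq0.
  move=> s Is s2; have := ode s (conj Is (ltW s2)); rewrite l0 addr0 => odes.
  have -> : (1 * s ^+ 2 + 0) * (k * s * phi s - (k * s ^+ 2 - - d) * dphi s) =
    s * (k * s ^+ 2 * phi s - s * (k * s ^+ 2 + d) * dphi s) by ring.
  by rewrite odes subrr mulr0.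
have s0 s : svalues s -> s != 0.
  move=> Js; apply/eqP => s0; have := ode s Js; have := phi_gt0 Js.
  rewrite s0 expr0n /= mulr0 add0r !mul0r => p0 /eqP.
  by rewrite mulf_eq0 (negbTE l0) gt_eqF.
have [d0|d0] := eqVneq d 0.
  have k0 : k != 0.
    apply/eqP => k0; have [s Js] := svalues_neq0; have := ode s Js.
    rewrite k0 d0 !mul0r !add0r mulr0 mul0r => /eqP.
    by rewrite mulf_eq0 (negbTE l0) gt_eqF // phi_gt0.
  right; have [|psi [k1 [k2 [k3 [P1 P2 P3 P4]]]]] := exp_solution k0 l0 s0.
    by move=> s Js; rewrite ode // d0 addr0.
  by exists psi, k1, k2, k3; split => //; rewrite gt_eqF.
pose m := l / d.
have lE : l = m * d by rewrite /m divfK.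
have m0 : m != 0 by rewrite mulf_neq0 ?invr_eq0.
have [m1|m1] := eqVneq m 1.
  left; apply: (@quadratic_of_weighted_odd_equation k d 1 0).
  - by rewrite d0 orbT.
  - by rewrite oner_neq0.
  move=> s Is s2; have := ode s (conj Is (ltW s2)); rewrite lE m1 => odes.
  have -> : (k * s ^+ 2 + d) * (1 * s * phi s - (1 * s ^+ 2 - 0) * dphi s) =
    s * ((k * s ^+ 2 + 1 * d) * phi s - s * (k * s ^+ 2 + d) * dphi s) by ring.
  by rewrite odes subrr mulr0.
have w0 s : svalues s -> k * s ^+ 2 + d != 0.
  move=> Js; apply/eqP => w0; have := ode s Js; rewrite w0 mulr0 mul0r => /eqP.
  rewrite mulf_eq0 [phi s == 0]gt_eqF ?phi_gt0 // orbF lE => /eqP w1.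
  have : (m - 1) * d = 0 by lra.
  by move/eqP; rewrite mulf_eq0 subr_eq0 (negbTE m1) (negbTE d0).
right; have [|k1 [k2 [k3 [P1 P2 P3]]]] := power_solution d0 m0 s0 w0.
  by move=> s Js; rewrite -lE ode.
exists (fun s => s `^ m), k1, k2, k3; split => //.
by apply: Or31; exists m.
Qed.

End ProfileEquations.

(** * Consequences of the conformal equation at one point *)

Section Forms.
Context {R : realType} {n : nat}.
Implicit Types (A P : 'M[R]_n) (b y z : 'rV[R]_n).

Definition bil A y z : R := (y *m A *m z^T) ord0 ord0.
Definition dot b y : R := (b *m y^T) ord0 ord0.

Lemma bilDl A y1 y2 z : bil A (y1 + y2) z = bil A y1 z + bil A y2 z.
Proof. by rewrite /bil !mulmxDl mxE. Qed.
Lemma bilDr A y z1 z2 : bil A y (z1 + z2) = bil A y z1 + bil A y z2.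
Proof. by rewrite /bil linearD mulmxDr mxE. Qed.
Lemma bilZl A t y z : bil A (t *: y) z = t * bil A y z.
Proof. by rewrite /bil -!scalemxAl mxE. Qed.
Lemma bilZr A t y z : bil A y (t *: z) = t * bil A y z.
Proof. by rewrite /bil linearZ -scalemxAr mxE. Qed.
Lemma dotD b y z : dot b (y + z) = dot b y + dot b z.
Proof. by rewrite /dot linearD mulmxDr mxE. Qed.
Lemma dotZ b t y : dot b (t *: y) = t * dot b y.
Proof. by rewrite /dot linearZ -scalemxAr mxE. Qed.

Definition bilE := (bilDl, bilDr, bilZl, bilZr, dotD, dotZ).

Lemma bilDm A1 A2 y z : bil (A1 + A2) y z = bil A1 y z + bil A2 y z.
Proof. by rewrite /bil mulmxDr mulmxDl mxE. Qed.
Lemma bilZm t A y z : bil (t *: A) y z = t * bil A y z.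
Proof. by rewrite /bil -scalemxAr -scalemxAl mxE. Qed.
Lemma dotDl b1 b2 y : dot (b1 + b2) y = dot b1 y + dot b2 y.
Proof. by rewrite /dot mulmxDl mxE. Qed.
Lemma dotZl t b y : dot (t *: b) y = t * dot b y.
Proof. by rewrite /dot -scalemxAl mxE. Qed.

Lemma dot0l y : dot 0 y = 0.
Proof. by rewrite /dot mul0mx mxE. Qed.
Lemma dot0r b : dot b 0 = 0.
Proof. by rewrite /dot trmx0 mulmx0 mxE. Qed.
Lemma bil0l A z : bil A 0 z = 0.
Proof. by rewrite /bil !mul0mx mxE. Qed.

Lemma bil_outer b y : bil (b^T *m b) y y = dot b y ^+ 2.
Proof.
rewrite /bil mulmxA -mulmxA -[y *m b^T]trmxK trmx_mul trmxK.
by rewrite mxE big_ord1 mxE.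
Qed.

Lemma bil_sym A y z : A^T = A -> bil A y z = bil A z y.
Proof.
move=> As; rewrite /bil.
have -> : z *m A *m y^T = (y *m A *m z^T)^T.
  by rewrite !trmx_mul trmxK As mulmxA.
by rewrite [RHS]mxE.
Qed.

Lemma dot_eq0 b : (forall y, dot b y = 0) -> b = 0.
Proof.
move=> b0; apply/rowP => k; have := b0 (delta_mx ord0 k).
by rewrite /dot trmx_delta -colE !mxE.
Qed.

Definition posdef A := A^T = A /\ forall y, y != 0 -> 0 < bil A y y.

Lemma posdef_unit A : posdef A -> A \in unitmx.
Proof.
move=> [_ Apos]; rewrite -row_free_unit -kermx_eq0; apply/negPn/negP => k0.
have := Apos (nz_row (kermx A)); rewrite nz_row_eq0 => /(_ k0).
have /sub_kermxP yA0 : (nz_row (kermx A) <= kermx A)%MS by exact: nz_row_sub.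
by rewrite /bil yA0 mul0mx mxE ltxx.
Qed.

(** The vector b# with A(b#, y) = b(y).  The adjugate formula for the inverse
makes it visibly continuous in A and b. *)
Definition sharp A b : 'rV[R]_n := b *m ((\det A)^-1 *: \adj A).
(** |b|^2 for the metric dual to A. *)
Definition dual_norm2 A b : R := dot b (sharp A b).

Section Metric.
Context {A : 'M[R]_n} {b : 'rV[R]_n} (A_pos : posdef A).

Lemma bil_ge0 y : 0 <= bil A y y.
Proof.
have [->|/A_pos.2/ltW//] := eqVneq y 0.
by rewrite bil0l.
Qed.

Lemma sharpK : sharp A b *m A = b.
Proof.
rewrite /sharp -mulmxA -scalemxAl mul_adj_mx scale_scalar_mx mulVf ?mulmx1 //.
by have := posdef_unit A_pos; rewrite unitmxE unitfE.
Qed.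

Lemma bil_sharp y : bil A (sharp A b) y = dot b y.
Proof. by rewrite /bil sharpK. Qed.

Lemma dual_norm2_gt0 : b != 0 -> 0 < dual_norm2 A b.
Proof.
move=> b0; rewrite /dual_norm2 -bil_sharp A_pos.2 //.
apply: contra_neq b0 => s0.
by rewrite -sharpK s0 mul0mx.
Qed.

(** Cauchy-Schwarz, from the squared length of y - (b(y)/N) b#. *)
Lemma dot_sqr_le y : b != 0 -> dot b y ^+ 2 <= dual_norm2 A b * bil A y y.
Proof.
move=> /dual_norm2_gt0; set N := dual_norm2 A b => N0.
have := bil_ge0 (y + (- (dot b y / N)) *: sharp A b).
rewrite !bilE (bil_sym y _ A_pos.1) !bil_sharp -/(dual_norm2 A b) -/N.
set B := dot b y; set Y := bil A y y => h.
have -> : B ^+ 2 = N * Y - N * (Y + - (B / N) * B + - (B / N) * (B + - (B / N) * N)).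
  by field; rewrite gt_eqF.
by rewrite gerBl; apply: mulr_ge0; [exact: ltW|lra].
Qed.

(** For s^2 <= |b|^2 and e orthogonal to b, this is the vector of the half-plane
R b# + R_+ e with alpha = 1 and beta = s. *)
Definition unit_vec (s : R) (e : 'rV[R]_n) :=
  (s / dual_norm2 A b) *: sharp A b +
  Num.sqrt ((1 - s ^+ 2 / dual_norm2 A b) / bil A e e) *: e.

Lemma unit_vecP s e : b != 0 -> e != 0 -> dot b e = 0 ->
  s ^+ 2 <= dual_norm2 A b ->
  bil A (unit_vec s e) (unit_vec s e) = 1 /\ dot b (unit_vec s e) = s.
Proof.
move=> /dual_norm2_gt0 + /A_pos.2 ee be; rewrite /unit_vec.
set N := dual_norm2 A b => N0 sN.
have h0 : 0 <= (1 - s ^+ 2 / N) / bil A e e.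
  by rewrite divr_ge0 ?(ltW ee) // subr_ge0 ler_pdivrMr // mul1r.
have := sqr_sqrtr h0; set t := Num.sqrt _ => t2.
rewrite !bilE (bil_sym e _ A_pos.1) !bil_sharp be -/(dual_norm2 A b) -/N.
split; last by field; rewrite gt_eqF.
rewrite !mulr0 addr0 add0r [t * (t * _)]mulrA -[t * t]expr2 t2; field.
by rewrite !gt_eqF.
Qed.

End Metric.

Lemma exists_orthogonal b : (1 < n)%N -> exists2 e, e != 0 & dot b e = 0.
Proof.
move=> n1; exists (nz_row (kermx b^T)).
  rewrite nz_row_eq0 -mxrank_eq0 mxrank_ker -lt0n subn_gt0.
  by apply: leq_ltn_trans n1; exact: rank_leq_col.
have /sub_kermxP : (nz_row (kermx b^T) <= kermx b^T)%MS by exact: nz_row_sub.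
move/(congr1 trmx); rewrite trmx_mul trmxK trmx0 /dot => ->.
by rewrite mxE.
Qed.

End Forms.

Section Pointwise.
Context {R : realType} {n : nat} {I : set R} {phi dphi : R -> R}.
Context {A P : 'M[R]_n} {b q : 'rV[R]_n}.
Hypothesis n_ge2 : (1 < n)%N.
Hypothesis I_open : open I.
Hypothesis I_itv : is_interval I.
Hypothesis phiD : forall s, I s -> is_derive s 1 phi (dphi s).
Hypothesis dphi_cont : forall s, I s -> {for s, continuous dphi}.
Hypothesis A_pos : posdef A.
Hypothesis b_neq0 : b != 0.
Let N := dual_norm2 A b.
Hypothesis phi_gt0 : forall s, svalues I N s -> 0 < phi s.
Hypothesis svalues_neq0 : svalues I N !=set0.
Hypothesis conformal_eq : forall y, bil A y y = 1 -> I (dot b y) ->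
  bil P y y * (phi (dot b y) - dot b y * dphi (dot b y)) +
  2 * dphi (dot b y) * dot q y = 0.

Let N_gt0 : 0 < N := dual_norm2_gt0 A_pos b_neq0.

Let bs := sharp A b.

(** Half-sum and half-difference of the conformal equation at the unit
vectors built on e and on -e. *)
Lemma even_odd_parts e s : e != 0 -> dot b e = 0 -> svalues I N s ->
  let t := Num.sqrt ((1 - s ^+ 2 / N) / bil A e e) in
  ((s / N) ^+ 2 * bil P bs bs + t ^+ 2 * bil P e e) * (phi s - s * dphi s) +
  2 * dphi s * (s / N * dot q bs) = 0 /\
  t * (s / N * (bil P bs e + bil P e bs) * (phi s - s * dphi s) +
    2 * dphi s * dot q e) = 0.
Proof.
move=> e0 be [Is sN] t.
have [y1 b1] := unit_vecP A_pos b_neq0 e0 be sN.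
have en0 : (- 1) *: e != 0 by rewrite scaleN1r oppr_eq0.
have ben : dot b ((-1) *: e) = 0 by rewrite dotZ be mulr0.
have [y2 b2] := unit_vecP A_pos b_neq0 en0 ben sN.
have := conformal_eq y1; have := conformal_eq y2; rewrite b1 b2.
move=> /(_ Is) + /(_ Is); rewrite /unit_vec !bilE -/N -/bs.
have -> : -1 * (-1 * bil A e e) = bil A e e by ring.
rewrite -/t => h1 h2.
split; lra.
Qed.

(** For e orthogonal to b, the parts of [even_odd_parts] are an even and an
odd equation whose coefficients are combinations of P(b#, b#), P(e, e), q(b#)
and of P(b#, e) + P(e, b#), q(e).  If phi is not exceptional, all of them vanish
for all e, and b# and the vectors e span the space. *)
Lemma pointwise_dichotomy :
  exceptional_profile I phi N \/ forall y, bil P y y = 0 /\ dot q y = 0.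
Proof.
have N0 : N != 0 by rewrite gt_eqF.
have [|nsol] := pselect (exceptional_profile I phi N); first by left.
right.
have allz e : e != 0 -> dot b e = 0 -> [/\ bil P bs bs = 0, bil P e e = 0,
    bil P bs e + bil P e bs = 0, dot q bs = 0 & dot q e = 0].
  move=> e0 be; have ee0 := A_pos.2 e e0.
  have een : bil A e e != 0 by rewrite gt_eqF.
  have t2 s : s ^+ 2 <= N -> Num.sqrt ((1 - s ^+ 2 / N) / bil A e e) ^+ 2 =
      (1 - s ^+ 2 / N) / bil A e e.
    move=> sN; rewrite sqr_sqrtr // divr_ge0 ?(ltW ee0) //.
    by rewrite subr_ge0 ler_pdivrMr // mul1r.
  pose ep := bil P e e / bil A e e.
  pose k := bil P bs bs / N - ep.
  pose l := N * ep.
  pose d := l - 2 * dot q bs.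
  have [/and3P[k0 l0 d0]|kld] := boolP [&& k == 0, l == 0 & d == 0]; last first.
    exfalso; apply: nsol.
    apply: (@exceptional_of_even_equation _ _ _ _ _ I_open I_itv phiD dphi_cont
       N_gt0 phi_gt0
       svalues_neq0 k l d).
      by move: kld; rewrite !negb_and.
    move=> s Js; have [+ _] := even_odd_parts e0 be Js.
    rewrite t2; last by case: Js.
    move=> E; apply/eqP; rewrite -subr_eq0; apply/eqP; rewrite -(mulr0 N) -E.
    by rewrite /d /l /k /ep; field; rewrite N0 een.
  have ep0 : ep = 0 by move: l0; rewrite mulf_eq0 (negbTE N0) => /eqP.
  have q0 : dot q bs = 0.
    by move/eqP: d0; rewrite /d (eqP l0); lra.
  have P0 : bil P bs bs = 0.
    by move: k0; rewrite /k ep0 subr0 mulf_eq0 invr_eq0 (negbTE N0) orbF => /eqP.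
  have Pe : bil P e e = 0.
    by move/eqP: ep0; rewrite mulf_eq0 invr_eq0 (negbTE een) orbF => /eqP.
  pose u := (bil P bs e + bil P e bs) / N.
  pose v := 2 * dot q e.
  have [/andP[u0 v0]|uv] := boolP ((u == 0) && (v == 0)); last first.
    exfalso; apply: nsol; left.
    apply: (@quadratic_of_weighted_odd_equation _ _ _ _ _ I_open I_itv phiD
      dphi_cont N_gt0
      phi_gt0 svalues_neq0 0 1 u v).
    - by rewrite oner_neq0 orbT.
    - by move: uv; rewrite negb_and.
    move=> s Is sN; have [_] := even_odd_parts e0 be (conj Is (ltW sN)).
    set t := Num.sqrt _ => /eqP; rewrite mulf_eq0.
    have /gt_eqF -> : 0 < t.
      by rewrite sqrtr_gt0 divr_gt0 // subr_gt0 ltr_pdivrMr // mul1r.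
    move=> /eqP /= E; rewrite mul0r add0r mul1r -[RHS]E /u /v.
    by field; rewrite N0.
  split => //.
    by move: u0; rewrite mulf_eq0 invr_eq0 (negbTE N0) orbF => /eqP.
  by move: v0; rewrite mulf_eq0 pnatr_eq0 => /eqP.
have [e1 e10 be1] := exists_orthogonal b n_ge2.
have [P0 _ _ q0 _] := allz e1 e10 be1.
move=> y; have [c [e [-> be]]] : exists c e, y = c *: bs + e /\ dot b e = 0.
  exists (dot b y / N), (y - (dot b y / N) *: bs); rewrite addrC subrK.
  by rewrite -scaleNr dotD dotZ -/(dual_norm2 A b) -/N mulNr divfK // subrr.
have [->|e0] := eqVneq e 0.
  by rewrite addr0 !bilE P0 q0 !mulr0.
have [_ Pe Pc _ qe] := allz e e0 be.
rewrite !bilE P0 q0 Pe qe !mulr0 !addr0 !add0r -mulrDr.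
by rewrite Pc mulr0.
Qed.

End Pointwise.

(** * Directional derivatives *)

Section DirectionalDerivatives.
Context {R : realType} {E : normedModType R}.
Implicit Types (f g : E -> R) (x v : E).

(** Reduces a directional derivative to the derivative of a function of one
real variable, for which a chain rule is available. *)
Lemma is_derive_line f x v (d : R) :
  is_derive x v f d <-> is_derive (0 : R) 1 (fun h : R => f (h *: v + x)) d.
Proof.
have eqD : 'D_v f x = 'D_(1 : R) (fun h : R => f (h *: v + x)) 0.
  rewrite /derive; set g1 := fun h => h^-1 *: _; set g2 := fun h => h^-1 *: _.
  suff -> : g1 = g2 by [].
  apply/funext => h; rewrite /g1 /g2 /=.
  by rewrite addr0 scale0r add0r [_%:A]mulr1.
split=> -[D1 D2]; apply: DeriveDef.
- exact: (derivable1P f x v).1.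
- by rewrite -eqD.
- exact: (derivable1P f x v).2.
- by rewrite eqD.
Qed.

Lemma is_derive_sqrt_mul_comp f g x v (df dg d : R) (phi : R -> R) :
  0 < f x -> is_derive x v f df -> is_derive x v g dg ->
  is_derive (g x / Num.sqrt (f x)) 1 phi d ->
  is_derive x v (fun x => Num.sqrt (f x) * phi (g x / Num.sqrt (f x)))
    ((phi (g x / Num.sqrt (f x)) - g x / Num.sqrt (f x) * d) /
       (2 * Num.sqrt (f x)) * df + d * dg).
Proof.
move=> fx0 /is_derive_line Df /is_derive_line Dg Dphi; apply/is_derive_line.
set f' := (fun h : R => f _) in Df; set g' := (fun h : R => g _) in Dg.
have f0 : f' 0 = f x by rewrite /f' scale0r add0r.
have g0 : g' 0 = g x by rewrite /g' scale0r add0r.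
rewrite -f0 -g0 in fx0 Dphi *.
have sf0 : Num.sqrt (f' 0) != 0 by rewrite gt_eqF // sqrtr_gt0.
have Ds := @is_derive1_comp R Num.sqrt f' 0 _ _ (is_derive1_sqrt fx0) Df.
have Dsi := @is_deriveV R (Num.sqrt \o f') 0 _ 1 sf0 Ds.
have Dq := is_deriveM Dg Dsi.
have Dp := @is_derive1_comp R phi _ 0 _ _ Dphi Dq.
have [D1 D2] := is_deriveM Ds Dp.
apply: (DeriveDef D1); rewrite D2 /GRing.scale /=.
rewrite !fctE /=; move: (Num.sqrt (f' 0)) sf0 => r r0.
by field.
Qed.

Lemma is_derive_big (I : Type) (r : seq I) (F : I -> E -> R) (dF : I -> R) x v :
  (forall i, is_derive x v (F i) (dF i)) ->
  is_derive x v (fun x => \sum_(i <- r) F i x) (\sum_(i <- r) dF i).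
Proof.
move=> DF; elim: r => [|i r IHr].
  rewrite big_nil; have -> : (fun x => \sum_(i <- [::]) F i x) = cst 0.
    by apply/funext => z; rewrite big_nil.
  exact: is_derive_cst.
rewrite big_cons.
have -> : (fun x => \sum_(j <- i :: r) F j x) =
    (F i + (fun x => \sum_(j <- r) F j x))%R.
  by apply/funext => z; rewrite big_cons.
exact: is_deriveD.
Qed.

Lemma is_derive_mull (c : R) f x v (d : R) :
  is_derive x v f d -> is_derive x v (fun x => c * f x) (c * d).
Proof. by move=> D; exact: (@is_deriveZ _ _ _ f c x v d). Qed.

Lemma is_derive_mulr (c : R) f x v (d : R) :
  is_derive x v f d -> is_derive x v (fun x => f x * c) (d * c).
Proof.
move=> /(is_derive_mull c); rewrite [d * c]mulrC.
by under eq_fun do rewrite mulrC.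
Qed.

End DirectionalDerivatives.

Section FormsInTheCoefficients.
Context {R : realType} {n : nat}.

Lemma bilEsum (A : 'M[R]_n) y z :
  bil A y z = \sum_l (\sum_k y ord0 k * A k l) * z ord0 l.
Proof. by rewrite /bil mxE; apply: eq_bigr => l _; rewrite !mxE. Qed.

Lemma dotEsum (b y : 'rV[R]_n) : dot b y = \sum_k b ord0 k * y ord0 k.
Proof. by rewrite /dot mxE; apply: eq_bigr => l _; rewrite !mxE. Qed.

Context {E : normedModType R}.

Lemma is_derive_bil (A : E -> 'M[R]_n) (dA : 'M[R]_n) y z (x v : E) :
  (forall k l, is_derive x v (fun x => A x k l) (dA k l)) ->
  is_derive x v (fun x => bil (A x) y z) (bil dA y z).
Proof.
move=> DA; rewrite bilEsum; under eq_fun do rewrite bilEsum.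
apply: is_derive_big => l; apply: is_derive_mulr.
by apply: is_derive_big => k; exact: is_derive_mull.
Qed.

Lemma is_derive_dot (b : E -> 'rV[R]_n) (db : 'rV[R]_n) y (x v : E) :
  (forall k, is_derive x v (fun x => b x ord0 k) (db ord0 k)) ->
  is_derive x v (fun x => dot (b x) y) (dot db y).
Proof.
move=> Db; rewrite dotEsum; under eq_fun do rewrite dotEsum.
by apply: is_derive_big => l; apply: is_derive_mulr.
Qed.

End FormsInTheCoefficients.

Section FormsInTheVector.
Context {R : realType} {n : nat}.

Lemma is_derive_bil_diag (A : 'M[R]_n) (y v : 'rV[R]_n) :
  is_derive y v (fun y => bil A y y) (bil A v y + bil A y v).
Proof.
apply/is_derive_line.
have -> : (fun h : R => bil A (h *: v + y) (h *: v + y)) =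
  ((fun h : R => bil A v v * h ^+ 2 + bil A y y) +
   (fun h : R => (bil A v y + bil A y v) * h))%R.
  by apply/funext => h; rewrite fctE !bilE; ring.
have D1 := is_derive_quadr (bil A v v) (bil A y y) 0.
have D2 := is_derive_mull (bil A v y + bil A y v) (is_derive_id (0 : R) (1 : R)).
have [D3 D4] := is_deriveD D1 D2.
by apply: (DeriveDef D3); rewrite D4; ring.
Qed.

Lemma is_derive_dot_r (b y v : 'rV[R]_n) : is_derive y v (dot b) (dot b v).
Proof.
apply/is_derive_line.
have -> : (fun h : R => dot b (h *: v + y)) = (fun h : R => 0 * h ^+ 2 + dot b y) +
   (fun h : R => dot b v * h).
  by apply/funext => h; rewrite fctE !bilE; ring.
have D1 := is_derive_quadr 0 (dot b y) 0.
have D2 := is_derive_mull (dot b v) (is_derive_id (0 : R) (1 : R)).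
have [D3 D4] := is_deriveD D1 D2.
by apply: (DeriveDef D3); rewrite D4; ring.
Qed.

End FormsInTheVector.

(** * Continuity of matrix-valued functions *)

Section MatrixContinuity.
Context {R : realType} {T : topologicalType} {x : T}.

Lemma eq_continuous_at (f g : T -> R) :
  f =1 g -> {for x, continuous f} -> {for x, continuous g}.
Proof. by move=> /funext ->. Qed.

Lemma continuous_sum_at (J : Type) (r : seq J) (F : J -> T -> R) :
  (forall i, {for x, continuous (F i)}) ->
  {for x, continuous (fun z => \sum_(i <- r) F i z)}.
Proof.
move=> cF; elim: r => [|i r IHr].
  apply: (@eq_continuous_at (fun=> 0)) => [z|]; last exact: cvg_cst.
  by rewrite big_nil.
apply: (@eq_continuous_at (fun z => F i z + \sum_(j <- r) F j z)) => [z|].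
  by rewrite big_cons.
by apply: cvgD IHr; exact: cF.
Qed.

Lemma continuous_prod_at (J : Type) (r : seq J) (F : J -> T -> R) :
  (forall i, {for x, continuous (F i)}) ->
  {for x, continuous (fun z => \prod_(i <- r) F i z)}.
Proof.
move=> cF; elim: r => [|i r IHr].
  apply: (@eq_continuous_at (fun=> 1)) => [z|]; last exact: cvg_cst.
  by rewrite big_nil.
apply: (@eq_continuous_at (fun z => F i z * \prod_(j <- r) F j z)) => [z|].
  by rewrite big_cons.
by apply: cvgM IHr; exact: cF.
Qed.

Lemma continuous_mul_at (f g : T -> R) :
  {for x, continuous f} -> {for x, continuous g} ->
  {for x, continuous (fun z => f z * g z)}.
Proof. by move=> cf cg; apply: cvgM. Qed.

Lemma continuous_sub_at (f g : T -> R) :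
  {for x, continuous f} -> {for x, continuous g} ->
  {for x, continuous (fun z => f z - g z)}.
Proof. by move=> cf cg; apply: cvgB. Qed.

Lemma continuous_cst_at (c : R) : {for x, continuous (fun _ : T => c)}.
Proof. exact: cvg_cst. Qed.

Definition entrywise_continuous m n (A : T -> 'M[R]_(m, n)) :=
  forall i j, {for x, continuous (fun z => A z i j)}.

Lemma continuous_mulmx m n p (A : T -> 'M[R]_(m, n)) (B : T -> 'M[R]_(n, p)) :
  entrywise_continuous A -> entrywise_continuous B ->
  entrywise_continuous (fun z => A z *m B z).
Proof.
move=> cA cB i j.
apply: (@eq_continuous_at (fun z => \sum_k A z i k * B z k j)) => [z|].
  by rewrite mxE.
by apply: continuous_sum_at => k; apply: continuous_mul_at.
Qed.

Lemma continuous_trmx m n (A : T -> 'M[R]_(m, n)) :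
  entrywise_continuous A -> entrywise_continuous (fun z => (A z)^T).
Proof.
move=> cA i j; apply: (@eq_continuous_at (fun z => A z j i)) => [z|].
  by rewrite mxE.
exact: cA.
Qed.

Lemma continuous_mxE key m n (F : 'I_m -> 'I_n -> T -> R) :
  (forall i j, {for x, continuous (F i j)}) ->
  entrywise_continuous (fun z => \matrix[key]_(i, j) F i j z).
Proof.
move=> cF i j; apply: (@eq_continuous_at (F i j)) => [z|]; last exact: cF.
by rewrite mxE.
Qed.

Lemma continuous_mx_add m n (A B : T -> 'M[R]_(m, n)) :
  entrywise_continuous A -> entrywise_continuous B ->
  entrywise_continuous (fun z => A z + B z).
Proof.
move=> cA cB i j; apply: (@eq_continuous_at (fun z => A z i j + B z i j)) => [z|].
  by rewrite mxE.
by apply: cvgD; [exact: cA|exact: cB].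
Qed.

Lemma continuous_mx_sum m n (J : Type) (r : seq J) (A : J -> T -> 'M[R]_(m, n)) :
  (forall k, entrywise_continuous (A k)) ->
  entrywise_continuous (fun z => \sum_(k <- r) A k z).
Proof.
move=> cA i j; apply: (@eq_continuous_at (fun z => \sum_(k <- r) A k z i j)) => [z|].
  by rewrite summxE.
by apply: continuous_sum_at => k; exact: cA.
Qed.

Lemma continuous_mx_scale m n (f : T -> R) (A : T -> 'M[R]_(m, n)) :
  {for x, continuous f} -> entrywise_continuous A ->
  entrywise_continuous (fun z => f z *: A z).
Proof.
move=> cf cA i j; apply: (@eq_continuous_at (fun z => f z * A z i j)) => [z|].
  by rewrite mxE.
by apply: continuous_mul_at.
Qed.

Lemma continuous_det n (A : T -> 'M[R]_n) :
  entrywise_continuous A -> {for x, continuous (fun z => \det (A z))}.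
Proof.
move=> cA; rewrite /determinant.
apply: continuous_sum_at => s; apply: continuous_mul_at.
  exact: continuous_cst_at.
by apply: continuous_prod_at => i; exact: cA.
Qed.

Lemma continuous_adjugate n (A : T -> 'M[R]_n) :
  entrywise_continuous A -> entrywise_continuous (fun z => \adj (A z)).
Proof.
move=> cA; apply: continuous_mxE => i j.
apply: continuous_mul_at; first exact: continuous_cst_at.
apply: continuous_det => k l.
apply: (@eq_continuous_at (fun z => A z (lift j k) (lift i l))) => [z|].
  by rewrite !mxE.
exact: cA.
Qed.

Lemma continuous_bil n (A : T -> 'M[R]_n) y z :
  entrywise_continuous A -> {for x, continuous (fun t => bil (A t) y z)}.
Proof.
move=> cA; apply: (@continuous_mulmx 1 n 1).
  by apply: continuous_mulmx => // i j; exact: continuous_cst_at.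
by move=> i j; exact: continuous_cst_at.
Qed.

Lemma continuous_dot n (b : T -> 'rV[R]_n) y :
  entrywise_continuous b -> {for x, continuous (fun t => dot (b t) y)}.
Proof.
move=> cb; apply: (@continuous_mulmx 1 n 1) => // i j.
exact: continuous_cst_at.
Qed.

Lemma continuous_dual_norm2 n (A : T -> 'M[R]_n) (b : T -> 'rV[R]_n) :
  posdef (A x) -> entrywise_continuous A -> entrywise_continuous b ->
  {for x, continuous (fun z => dual_norm2 (A z) (b z))}.
Proof.
move=> /posdef_unit; rewrite unitmxE unitfE => det0 cA cb.
apply: (@continuous_mulmx 1 n 1) => //; apply: continuous_trmx.
apply: continuous_mulmx => //.
apply: continuous_mx_scale; last exact: continuous_adjugate.
by apply: cvgV => //; exact: continuous_det.
Qed.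

End MatrixContinuity.

(** * Complete lifts of alpha^2, beta and F *)

Section CompleteLift.
Context {R : realType} {n : nat} {M : topologicalType} {A : atlas R n M}.
Implicit Types (a : riemannian_metric A) (b : one_form A) (V : vector_field A).
Implicit Types (i : chart A) (x y : 'rV[R]_n).

Definition vdiff V i x : 'M[R]_n :=
  \matrix_(k, l) pderiv k (fun x' => V i x' ord0 l) x.

(** The matrix of the quadratic form V^c(alpha^2), that is the Lie derivative
of a along V. *)
Definition lift_metric V a i x : 'M[R]_n :=
  \sum_k V i x ord0 k *: \matrix_(l, m) pderiv k (fun x' => a i x' l m) x +
  vdiff V i x *m a i x + (vdiff V i x *m a i x)^T.

(** The coefficients of V^c(beta), that is the Lie derivative of b along V. *)
Definition lift_form V b i x : 'rV[R]_n :=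
  \sum_k V i x ord0 k *: \row_l pderiv k (fun x' => b i x' ord0 l) x +
  b i x *m (vdiff V i x)^T.

Lemma pderivP i (f : 'rV[R]_n -> R) (k : 'I_n) x :
  smooth_on (img i) f -> img i x ->
  is_derive x (delta_mx ord0 k) f (pderiv k f x).
Proof. by move=> /(_ 1%N)[_ /(_ k)[Df _]] /Df /derivableP. Qed.

Lemma pderiv_val (f : 'rV[R]_n -> R) (k : 'I_n) x (d : R) :
  is_derive x (delta_mx ord0 k) f d -> pderiv k f x = d.
Proof. by case. Qed.

Lemma pderiv_alpha2_x a i x y k : img i x ->
  is_derive x (delta_mx ord0 k) (fun x' => alpha2 a i x' y)
    (bil (\matrix_(l, m) pderiv k (fun x' => a i x' l m) x) y y).
Proof.
move=> ix; apply: is_derive_bil => l m; rewrite mxE.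
exact: pderivP (rm_smooth a i l m) ix.
Qed.

Lemma pderiv_alpha2_y a i x y l : img i x ->
  is_derive y (delta_mx ord0 l) (alpha2 a i x) (2 * (y *m a i x) ord0 l).
Proof.
move=> ix; have := is_derive_bil_diag (a i x) y (delta_mx ord0 l).
rewrite (bil_sym (delta_mx ord0 l) y (rm_sym a ix)).
have -> : bil (a i x) y (delta_mx ord0 l) = (y *m a i x) ord0 l.
  by rewrite /bil trmx_delta -colE mxE.
by rewrite -mulr2n mulr_natl.
Qed.

Lemma beta_dot b i x y : beta b i x y = dot (b i x) y.
Proof. by rewrite dotEsum. Qed.

Lemma pderiv_beta_x b i x y k : img i x ->
  is_derive x (delta_mx ord0 k) (fun x' => beta b i x' y)
    (dot (\row_l pderiv k (fun x' => b i x' ord0 l) x) y).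
Proof.
move=> ix; under eq_fun do rewrite beta_dot.
apply: is_derive_dot => l; rewrite mxE.
exact: pderivP (of_smooth b i l) ix.
Qed.

Lemma pderiv_beta_y b i x y l :
  is_derive y (delta_mx ord0 l) (beta b i x) (b i x ord0 l).
Proof.
have := is_derive_dot_r (b i x) y (delta_mx ord0 l).
rewrite {2}/dot trmx_delta -colE mxE.
by rewrite (_ : dot _ = beta b i x) //; apply/funext => z; rewrite beta_dot.
Qed.

Lemma bil_suml (r : seq 'I_n) (F : 'I_n -> 'M[R]_n) y z :
  bil (\sum_(k <- r) F k) y z = \sum_(k <- r) bil (F k) y z.
Proof. by rewrite /bil mulmx_sumr mulmx_suml summxE. Qed.

Lemma lift_alpha2E V a i x y : img i x ->
  complete_lift V (alpha2 a) i x y = bil (lift_metric V a i x) y y.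
Proof.
move=> ix; rewrite /complete_lift /lift_metric.
rewrite !bilDm bil_suml -addrA; congr (_ + _).
  apply: eq_bigr => k _; rewrite (pderiv_val (pderiv_alpha2_x a y k ix)).
  by rewrite /bil -scalemxAr -scalemxAl [RHS]mxE.
have -> : bil (vdiff V i x *m a i x)^T y y = bil (vdiff V i x *m a i x) y y.
  rewrite /bil; set B := _ *m a i x.
  by rewrite -[in RHS](trmxK (y *m B *m y^T)) [in RHS]mxE !trmx_mul trmxK mulmxA.
have -> : bil (vdiff V i x *m a i x) y y =
    \sum_k \sum_l y ord0 k * vdiff V i x k l * (y *m a i x) ord0 l.
  rewrite /bil mulmxA -mulmxA -[a i x *m y^T]trmxK trmx_mul trmxK (rm_sym a ix).
  rewrite mxE exchange_big; apply: eq_bigr => l _ /=; rewrite !mxE mulr_suml.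
  by apply: eq_bigr => k _.
rewrite -mulr2n -mulr_natl mulr_sumr; apply: eq_bigr => k _.
rewrite mulr_sumr; apply: eq_bigr => l _.
rewrite (pderiv_val (pderiv_alpha2_y a y l ix)).
by rewrite [vdiff V i x k l]mxE; ring.
Qed.

Lemma lift_betaE V b i x y : img i x ->
  complete_lift V (beta b) i x y = dot (lift_form V b i x) y.
Proof.
move=> ix; rewrite /complete_lift /lift_form.
rewrite [RHS]/dot mulmxDl [RHS]mxE mulmx_suml summxE; congr (_ + _).
  apply: eq_bigr => k _; rewrite (pderiv_val (pderiv_beta_x b y k ix)).
  by rewrite -scalemxAl [RHS]mxE.
rewrite -mulmxA -trmx_mul [RHS]mxE exchange_big; apply: eq_bigr => l _ /=.
rewrite [(_ *m _)^T _ _]mxE [(_ *m _) _ _]mxE mulr_sumr; apply: eq_bigr => k _.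
rewrite (pderiv_val (pderiv_beta_y b i x y l)).
by rewrite [vdiff V i x k l]mxE mulrC.
Qed.

(** Chain rule for alpha phi(beta/alpha); d stands for phi'(s). *)
Lemma lift_ab_funE V a b (phi : R -> R) (d : R) i x y : img i x -> y != 0 ->
  let s := beta b i x y / alpha a i x y in
  is_derive s 1 phi d ->
  complete_lift V (ab_fun a b phi) i x y =
  (phi s - s * d) / (2 * alpha a i x y) * complete_lift V (alpha2 a) i x y +
  d * complete_lift V (beta b) i x y.
Proof.
move=> ix y0 s Ds; have al0 := rm_pos a ix y0.
set B := _ / (2 * _); rewrite /complete_lift.
have Ex k : pderiv k (fun x' => ab_fun a b phi i x' y) x =
    B * pderiv k (fun x' => alpha2 a i x' y) x +
    d * pderiv k (fun x' => beta b i x' y) x.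
  have D1 := pderiv_alpha2_x a y k ix; have D2 := pderiv_beta_x b y k ix.
  have [_] := is_derive_sqrt_mul_comp al0 D1 D2 Ds.
  by rewrite (pderiv_val D1) (pderiv_val D2).
have Ey l : pderiv l (ab_fun a b phi i x) y =
    B * pderiv l (alpha2 a i x) y + d * pderiv l (beta b i x) y.
  have D1 := pderiv_alpha2_y a y l ix; have D2 := pderiv_beta_y b i x y l.
  have [_] := is_derive_sqrt_mul_comp al0 D1 D2 Ds.
  by rewrite (pderiv_val D1) (pderiv_val D2).
rewrite [in RHS]mulrDr [d * (_ + _)]mulrDr !mulr_sumr.
rewrite addrACA; congr (_ + _); rewrite -big_split; apply: eq_bigr => k _ /=.
  by rewrite Ex; ring.
rewrite !mulr_sumr -big_split; apply: eq_bigr => l _ /=.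
by rewrite Ey; ring.
Qed.

Lemma continuous_on_img (f : 'rV[R]_n -> R) i x : smooth_on (img i) f -> img i x ->
  {for x, continuous f}.
Proof. by move=> /(_ 0%N)[+ _] => /[apply]. Qed.

Lemma continuous_pderiv_on_img (f : 'rV[R]_n -> R) k i x :
  smooth_on (img i) f -> img i x -> {for x, continuous (pderiv k f)}.
Proof. by move=> /(_ 1%N)[_ /(_ k)[_ [+ _]]] => /[apply]. Qed.

Lemma continuous_lift_metric V a i x : img i x ->
  @entrywise_continuous R _ x n n (lift_metric V a i).
Proof.
move=> ix.
have cB : @entrywise_continuous R _ x n n (fun z => vdiff V i z *m a i z).
  apply: continuous_mulmx => [|k j].
    by apply: continuous_mxE => k j; exact: continuous_pderiv_on_img (vf_smooth V i j) ix.
  exact: continuous_on_img (rm_smooth a i k j) ix.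
apply: continuous_mx_add; last exact: continuous_trmx.
apply: continuous_mx_add => //; apply: continuous_mx_sum => k.
apply: continuous_mx_scale; first exact: continuous_on_img (vf_smooth V i k) ix.
apply: continuous_mxE => l m.
exact: continuous_pderiv_on_img (rm_smooth a i l m) ix.
Qed.

Lemma continuous_lift_form V b i x : img i x ->
  @entrywise_continuous R _ x 1 n (lift_form V b i).
Proof.
move=> ix; apply: continuous_mx_add.
  apply: continuous_mx_sum => k; apply: continuous_mx_scale.
    exact: continuous_on_img (vf_smooth V i k) ix.
  apply: continuous_mxE => _ m.
  exact: continuous_pderiv_on_img (of_smooth b i m) ix.
apply: continuous_mulmx => [k j|].
  by rewrite (ord1 k); exact: continuous_on_img (of_smooth b i j) ix.
apply: continuous_trmx; apply: continuous_mxE => k j.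
exact: continuous_pderiv_on_img (vf_smooth V i j) ix.
Qed.

Lemma posdef_rm a i x : img i x -> posdef (a i x).
Proof. by move=> ix; split; [exact: rm_sym|move=> y; exact: rm_pos]. Qed.

End CompleteLift.

(** * Change of chart and near-maxima *)

Section ChartChange.
Context {R : realType} {n : nat} {M : topologicalType} {A : atlas R n M}.
Implicit Types (a : riemannian_metric A) (b : one_form A).

Definition chart_open (i : chart A) (U : set 'rV[R]_n) : set M :=
  [set p | cdom i p /\ U (crd i p)].

Lemma near_img (i : chart A) x : img i x -> \forall z \near x, img i z.
Proof. by move=> ix; apply: open_nbhs_nbhs; split => //; exact: img_open. Qed.

Lemma open_chart_open i U : open U -> open (chart_open i U).
Proof.
move=> Uo; rewrite openE => p [ip Up].
have ci := crd_continuous ip.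
have n1 : \forall q \near p, cdom i q by exact: open_nbhs_nbhs (conj (cdom_open i) ip).
have n2 : \forall q \near p, U (crd i q).
  exact: ci (open_nbhs_nbhs (conj Uo Up)).
by near=> q; split; near: q.
Unshelve. all: by end_near. Qed.

(** Any chart point above [chart_open i U] can be moved to the chart i, where
the estimates on U are available. *)
Lemma chart_openP i U j x : img j x -> chart_open i U (crd_inv j x) ->
  [/\ overlap j i x, overlap i j (transition j i x),
      transition i j (transition j i x) = x, img i (transition j i x) &
      U (transition j i x)].
Proof.
move=> [p jp <-]; rewrite /transition crdK // => -[ip Up].
split=> //; first by exists p.
- by exists p.
- by rewrite !crdK.
- by exists p.
Qed.

Lemma alpha2_transition a i j x y : overlap i j x ->
  alpha2 a i x y = alpha2 a j (transition i j x) (y *m jac i j x).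
Proof.
by move=> /(rm_trans a); rewrite /alpha2 => ->; rewrite trmx_mul !mulmxA.
Qed.

Lemma beta_transition b i j x y : overlap i j x ->
  beta b i x y = beta b j (transition i j x) (y *m jac i j x).
Proof.
move=> /(of_trans b); rewrite !beta_dot /dot => ->.
by rewrite trmx_mul !mulmxA.
Qed.

Lemma one_form_neq0_transition b i j x : overlap i j x ->
  b i x != 0 -> b j (transition i j x) != 0.
Proof.
move=> /(of_trans b) ->; apply: contra_neq => ->.
by rewrite mul0mx.
Qed.

Lemma beta_sqr_le a b i x y : img i x -> b i x != 0 ->
  beta b i x y ^+ 2 <= dual_norm2 (a i x) (b i x) * alpha2 a i x y.
Proof. by move=> ix b0; rewrite beta_dot; exact: dot_sqr_le (posdef_rm a ix) y b0. Qed.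

End ChartChange.

(** Either f takes two values f x1 < f x2 on W, and then f < f x2 near x1;
or f is constant on W.  The point x2 need not lie in U. *)
Lemma locally_near_maximum {R : realType} {T : topologicalType} (W : set T)
    (f : T -> R) :
  open W -> W !=set0 -> (forall x, W x -> {for x, continuous f}) ->
  exists x2 U, [/\ W x2, open U, U !=set0, U `<=` W & forall x, U x -> f x <= f x2].
Proof.
move=> Wo [x0 Wx0] cf.
have [[x1 [x2 [W1 W2 lt12]]]|noinc] :=
    pselect (exists x1 x2, [/\ W x1, W x2 & f x1 < f x2]).
  exists x2, (interior [set x | W x /\ f x < f x2]); split => //.
  - exact: open_interior.
  - exists x1; have n1 : \forall x \near x1, W x by exact: open_nbhs_nbhs.
    have n2 : \forall x \near x1, f x < f x2.
      exact: cf W1 _ (open_nbhs_nbhs (conj (@open_lt R _) lt12)).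
    by near=> x; split; near: x.
  - by move=> x /interior_subset[].
  - by move=> x /interior_subset[_ /ltW].
exists x0, W; split=> //; first by exists x0.
by move=> x Wx; rewrite leNgt; apply/negP => lt; apply: noinc; exists x0, x.
Unshelve. all: by end_near. Qed.

(** * Conformal fields of an (alpha,beta)-metric *)

Section ABMetric.
Context {R : realType} {n : nat} {M : topologicalType} {A : atlas R n M}.
Context (F : ab_metric A).
Let a := ab_a F.
Let b := ab_b F.
Let phi := ab_phi F.
Let I := ab_dom F.
Let dphi := derive1 phi.

Lemma is_derive_phi s : I s -> is_derive s 1 phi (dphi s).
Proof.
move=> Is; rewrite /dphi derive1E; apply: derivableP.
exact: (@ab_phi_smooth _ _ _ _ F 0%N s Is).
Qed.

Lemma continuous_dphi s : I s -> {for s, continuous dphi}.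
Proof.
move=> Is; apply: differentiable_continuous; apply/derivable1_diffP.
exact: (@ab_phi_smooth _ _ _ _ F 1%N s Is).
Qed.

Lemma ab_F_homE i x y : ab_F F i x y =
  alpha a i x y * phi (beta b i x y / alpha a i x y).
Proof. by []. Qed.

Lemma alpha_gt0 i x y : img i x -> y != 0 -> 0 < alpha a i x y.
Proof. by move=> ix y0; rewrite sqrtr_gt0; exact: rm_pos. Qed.

Lemma alpha_sqr i x y : img i x -> alpha a i x y ^+ 2 = alpha2 a i x y.
Proof. by move=> ix; rewrite sqr_sqrtr //; exact: bil_ge0 (posdef_rm a ix) y. Qed.

Lemma phi_gt0_conic i x y : ab_conic F i x y ->
  0 < phi (beta b i x y / alpha a i x y).
Proof.
move=> cy; have := ab_pos cy; case: cy => ix y0 _.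
by rewrite -/(ab_F F i x y) ab_F_homE pmulr_rgt0 // alpha_gt0.
Qed.

Lemma svalue_conic i x y : ab_conic F i x y -> b i x != 0 ->
  svalues I (dual_norm2 (a i x) (b i x)) (beta b i x y / alpha a i x y).
Proof.
move=> [ix y0 Is] b0; split => //.
have al0 := alpha_gt0 ix y0.
rewrite exprMn exprVn ler_pdivrMr ?exprn_gt0 // alpha_sqr //.
exact: beta_sqr_le.
Qed.

Section Residual.
Context (V : vector_field A) (c : M -> R).

Definition metric_residual i x : 'M[R]_n :=
  lift_metric V a i x + (- (4 * c (crd_inv i x))) *: a i x.
Definition form_residual i x : 'rV[R]_n :=
  lift_form V b i x + (- (2 * c (crd_inv i x))) *: b i x.

Lemma metric_residualE i x y z : bil (metric_residual i x) y z =
  bil (lift_metric V a i x) y z - 4 * c (crd_inv i x) * bil (a i x) y z.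
Proof. by rewrite /metric_residual bilDm bilZm mulNr. Qed.

Lemma form_residualE i x y : dot (form_residual i x) y =
  dot (lift_form V b i x) y - 2 * c (crd_inv i x) * dot (b i x) y.
Proof. by rewrite /form_residual dotDl dotZl mulNr. Qed.

Definition residual_free i x :=
  forall y, bil (metric_residual i x) y y = 0 /\ dot (form_residual i x) y = 0.

(** The equation (E) of the introduction. *)
Lemma conformal_residualE i x y : ab_conic F i x y ->
  let s := beta b i x y / alpha a i x y in
  complete_lift V (ab_F F) i x y = 2 * c (crd_inv i x) * ab_F F i x y <->
  bil (metric_residual i x) y y * (phi s - s * dphi s) +
    2 * alpha a i x y * dphi s * dot (form_residual i x) y = 0.
Proof.
move=> [ix y0 Is] s; have al0 := alpha_gt0 ix y0.
have aln : alpha a i x y != 0 by rewrite gt_eqF.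
rewrite /ab_F (lift_ab_funE V ix y0 (is_derive_phi Is)) -/a -/b -/phi -/s.
rewrite /ab_fun -/s !metric_residualE !form_residualE.
rewrite -[bil (a i x) y y]/(alpha2 a i x y) -beta_dot.
rewrite lift_alpha2E // lift_betaE // -alpha_sqr //.
have -> : beta b i x y = s * alpha a i x y by rewrite /s divfK.
move: s (bil _ y y) (dot _ y) (alpha _ _ _ _) aln (phi s) (dphi s) (c _).
move=> t P Q al aln p d k.
have E : (p - t * d) / (2 * al) * P + d * Q - 2 * k * (al * p) =
  (2 * al)^-1 * ((P - 4 * k * al ^+ 2) * (p - t * d) +
   2 * al * d * (Q - 2 * k * (t * al))) by field.
split=> [h|h].
  have : (2 * al) * ((p - t * d) / (2 * al) * P + d * Q - 2 * k * (al * p)) = 0.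
    by rewrite h subrr mulr0.
  by rewrite E mulVKf // mulf_neq0 // pnatr_eq0.
by apply/eqP; rewrite -subr_eq0 E h mulr0.
Qed.

Lemma residual_freeP i x : img i x -> residual_free i x <-> forall y,
  complete_lift V (alpha2 a) i x y = 4 * c (crd_inv i x) * alpha2 a i x y /\
  complete_lift V (beta b) i x y = 2 * c (crd_inv i x) * beta b i x y.
Proof.
move=> ix; split=> h y; have := h y.
  rewrite !metric_residualE !form_residualE.
  rewrite lift_alpha2E // lift_betaE // beta_dot.
  rewrite -[bil (a i x) y y]/(alpha2 a i x y) => -[h1 h2].
  by split; lra.
rewrite lift_alpha2E // lift_betaE // beta_dot.
rewrite !metric_residualE !form_residualE.
by rewrite -[bil (a i x) y y]/(alpha2 a i x y) => -[-> ->]; split; lra.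
Qed.

Lemma conformal_of_residual_free :
  (forall i x, img i x -> residual_free i x) -> conformal_with V c F.
Proof.
move=> h i x y cy; apply/conformal_residualE => //.
have [ix _ _] := cy; have [-> ->] := h i x ix y.
by rewrite mul0r mulr0 addr0.
Qed.

Hypothesis n_ge2 : (1 < n)%N.
Hypothesis V_conformal : conformal_with V c F.

(** By homogeneity it is enough to use the conformal equation at vectors with
alpha = 1. *)
Lemma exceptional_or_residual_free i x : img i x -> b i x != 0 ->
  exceptional_profile I phi (dual_norm2 (a i x) (b i x)) \/ residual_free i x.
Proof.
move=> ix b0; have ap := posdef_rm a ix.
have conicN1 y : bil (a i x) y y = 1 -> I (dot (b i x) y) ->
    [/\ alpha a i x y = 1, beta b i x y = dot (b i x) y & ab_conic F i x y].
  move=> y1 Iy; have a1 : alpha a i x y = 1.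
    by rewrite /alpha /alpha2 -/(bil _ y y) y1 sqrtr1.
  split; rewrite ?beta_dot //; split => //.
    by apply/eqP => y0; move: y1; rewrite y0 bil0l; lra.
  by rewrite -/a -/b a1 divr1 beta_dot.
apply: (@pointwise_dichotomy R n I phi dphi (a i x) (metric_residual i x) (b i x)
  (form_residual i x)) => //.
- exact: ab_dom_open.
- exact: ab_dom_interval.
- exact: is_derive_phi.
- exact: continuous_dphi.
- move=> s [Is sN]; have [e e0 be] := exists_orthogonal (b i x) n_ge2.
  have [y1 ys] := unit_vecP ap b0 e0 be sN.
  have [|a1 b1 /phi_gt0_conic] := conicN1 _ y1; first by rewrite ys.
  by rewrite b1 a1 divr1 ys.
- have [y cy _] := ab_nondeg F ix; exists (beta b i x y / alpha a i x y).
  exact: svalue_conic.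
- move=> y y1 Iy; have [a1 b1 cy] := conicN1 y y1 Iy.
  have /= := (conformal_residualE cy).1 (V_conformal cy).
  by rewrite a1 b1 divr1 mulr1.
Qed.

(** The first term of the conformal equation is even in y and the second
is odd, because s = 0 for all y. *)
Lemma residual_metric_eq0 i x y : img i x -> b i x = 0 ->
  bil (metric_residual i x) y y = 0.
Proof.
move=> ix b0; have [->|y0] := eqVneq y 0; first by rewrite bil0l.
have be0 z : beta b i x z = 0 by rewrite beta_dot b0 dot0l.
have [y1 cy1 _] := ab_nondeg F ix.
have I0 : I 0 by case: cy1 => _ _; rewrite -/b be0 mul0r.
have conic0 z : z != 0 -> ab_conic F i x z.
  by move=> z0; split => //; rewrite -/b be0 mul0r.
have p0 : 0 < phi 0 by have := phi_gt0_conic cy1; rewrite be0 mul0r.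
have yn0 : - y != 0 by rewrite oppr_eq0.
have /= := (conformal_residualE (conic0 y y0)).1 (V_conformal (conic0 y y0)).
have /= := (conformal_residualE (conic0 _ yn0)).1 (V_conformal (conic0 _ yn0)).
have -> : alpha a i x (- y) = alpha a i x y.
  by rewrite /alpha /alpha2 -!/(bil _ _ _) -scaleN1r !bilE; congr Num.sqrt; ring.
rewrite !be0 !mul0r !subr0 -scaleN1r !bilE.
move: (2 * alpha _ _ _ _ * _) => X h1 h2.
have : 2 * phi 0 * bil (metric_residual i x) y y = 0 by lra.
by move/eqP; rewrite mulf_eq0 gt_eqF ?mulr_gt0 //= => /eqP.
Qed.

Lemma locally_zero_lift_form i x : img i x -> (\forall z \near x, b i z = 0) ->
  lift_form V b i x = 0.
Proof.
move=> ix b0; rewrite /lift_form (nbhs_singleton b0) mul0mx addr0.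
apply: big1 => k _; apply/rowP => l; rewrite !mxE /pderiv.
rewrite (_ : derive _ _ _ = 0) ?mulr0 //.
rewrite (@near_eq_derive _ _ _ _ (cst 0)) ?derive_cst //.
by near=> z; rewrite (_ : b i z = 0) ?mxE //; near: z.
Unshelve. all: by end_near. Qed.

(** At a zero of beta, phi'(0) may vanish, and then the conformal equation at
this point says nothing about the 1-form.  Continuity from the points with
beta <> 0 is used instead. *)
Lemma residual_free_of_neq0 :
  (forall i x, img i x -> b i x != 0 -> residual_free i x) ->
  forall i x, img i x -> residual_free i x.
Proof.
move=> good i x ix y; have [b0|/(good i x ix)//] := eqVneq (b i x) 0.
split; first exact: residual_metric_eq0.
have -> : dot (form_residual i x) y = dot (lift_form V b i x) y.
  by rewrite /form_residual b0 scaler0 addr0.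
have [->|y0] := eqVneq y 0; first by rewrite dot0r.
pose E z := 2 * bil (a i z) y y * dot (lift_form V b i z) y -
  bil (lift_metric V a i z) y y * dot (b i z) y.
have ay0 : 0 < bil (a i x) y y by exact: rm_pos.
have E0 : E x = 2 * bil (a i x) y y * dot (lift_form V b i x) y.
  by rewrite /E b0 dot0l mulr0 subr0.
apply/eqP; apply: contrapT => /negP Q0.
have Ex0 : E x != 0 by rewrite E0 !mulf_neq0 ?pnatr_eq0 ?(gt_eqF ay0).
have cE : {for x, continuous E}.
  apply: continuous_sub_at; apply: continuous_mul_at.
  - apply: continuous_mul_at; first exact: continuous_cst_at.
    by apply: continuous_bil => k l; exact: continuous_on_img (rm_smooth a i k l) ix.
  - by apply: continuous_dot; exact: continuous_lift_form.
  - by apply: continuous_bil; exact: continuous_lift_metric.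
  - apply: continuous_dot => k l; rewrite (ord1 k).
    exact: continuous_on_img (of_smooth b i l) ix.
have nE : \forall z \near x, E z != 0.
  exact: cE (open_nbhs_nbhs (conj (@open_neq R 0) Ex0)).
have nI : \forall z \near x, img i z by exact: near_img.
have nb : \forall z \near x, b i z = 0.
  near=> z; apply/eqP; apply: contrapT => /negP bz0.
  have iz : img i z by near: z.
  have : E z != 0 by near: z.
  have [] := good i z iz bz0 y.
  rewrite !metric_residualE !form_residualE => h1 h2.
  have e1 : bil (lift_metric V a i z) y y =
      4 * c (crd_inv i z) * bil (a i z) y y by lra.
  have e2 : dot (lift_form V b i z) y =
      2 * c (crd_inv i z) * dot (b i z) y by lra.
  rewrite /E e1 e2.
  by move=> /eqP; apply; ring.
by move/negP: Q0; apply; rewrite locally_zero_lift_form // dot0l.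
Unshelve. all: by end_near. Qed.

(** The function c may be discontinuous, so openness is shown for
the property that (P, Q) is not a multiple of (2 alpha^2, beta), which does not
mention c and is detected by the continuous functions D1 and D2.  At a point the
two properties agree: if P = 4 lam alpha^2 and Q = 2 lam beta, the conformal
equation reads 4 (lam - c) alpha^2 phi = 0. *)
Lemma residual_neighborhood i x : img i x -> b i x != 0 -> ~ residual_free i x ->
  \forall z \near x, [/\ img i z, b i z != 0 & ~ residual_free i z].
Proof.
move=> ix b0 bad.
have [y0 by0] : exists y, dot (b i x) y != 0.
  apply: contrapT => h; move/eqP: b0; apply; apply: dot_eq0 => y.
  by apply/eqP; apply: contrapT => /negP hy; apply: h; exists y.
pose D1 z y := bil (lift_metric V a i z) y y * dot (b i z) y0 -
  2 * dot (lift_form V b i z) y0 * bil (a i z) y y.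
pose D2 z y := dot (lift_form V b i z) y * dot (b i z) y0 -
  dot (lift_form V b i z) y0 * dot (b i z) y.
have Dfree z y : residual_free i z -> D1 z y = 0 /\ D2 z y = 0.
  move=> good; have [] := good y; have [_] := good y0.
  rewrite !metric_residualE !form_residualE => h0 h1 h2.
  have e0 : dot (lift_form V b i z) y0 = 2 * c (crd_inv i z) * dot (b i z) y0 by lra.
  have e1 : bil (lift_metric V a i z) y y =
    4 * c (crd_inv i z) * bil (a i z) y y by lra.
  have e2 : dot (lift_form V b i z) y = 2 * c (crd_inv i z) * dot (b i z) y by lra.
  by rewrite /D1 /D2 e0 e1 e2; split; ring.
have cb y : {for x, continuous (fun z => dot (b i z) y)}.
  apply: continuous_dot => k l; rewrite (ord1 k).
  exact: continuous_on_img (of_smooth b i l) ix.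
have cq y : {for x, continuous (fun z => dot (lift_form V b i z) y)}.
  by apply: continuous_dot; exact: continuous_lift_form.
have cp y : {for x, continuous (fun z => bil (lift_metric V a i z) y y)}.
  by apply: continuous_bil; exact: continuous_lift_metric.
have ca y : {for x, continuous (fun z => bil (a i z) y y)}.
  by apply: continuous_bil => k l; exact: continuous_on_img (rm_smooth a i k l) ix.
have [D [cD DP Dx]] : exists D : 'rV[R]_n -> R, [/\ {for x, continuous D},
    forall z, residual_free i z -> D z = 0 & D x != 0].
  apply: contrapT => noD; apply: bad.
  have D1x y : D1 x y = 0.
    apply/eqP; apply: contrapT => /negP ne; apply: noD; exists (D1 ^~ y).
    split => // [|z /(Dfree z y)[]//].
    apply: continuous_sub_at; apply: continuous_mul_at => //.
    by apply: continuous_mul_at => //; exact: continuous_cst_at.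
  have D2x y : D2 x y = 0.
    apply/eqP; apply: contrapT => /negP ne; apply: noD; exists (D2 ^~ y).
    split => // [|z /(Dfree z y)[]//].
    by apply: continuous_sub_at; apply: continuous_mul_at.
  pose lam := dot (lift_form V b i x) y0 / (2 * dot (b i x) y0).
  have Pl y : bil (lift_metric V a i x) y y = 4 * lam * bil (a i x) y y.
    have := D1x y; rewrite /D1 => h.
    apply: (mulIf by0); move/eqP: h; rewrite subr_eq0 => /eqP ->.
    by rewrite /lam; field.
  have Ql y : dot (lift_form V b i x) y = 2 * lam * dot (b i x) y.
    have := D2x y; rewrite /D2 => h.
    apply: (mulIf by0); move/eqP: h; rewrite subr_eq0 => /eqP ->.
    by rewrite /lam; field.
  have lamE : lam = c (crd_inv i x).
    have [y cy _] := ab_nondeg F ix; have p0 := phi_gt0_conic cy.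
    have /= := (conformal_residualE cy).1 (V_conformal cy).
    have [_ yn0 _] := cy; have al0 := alpha_gt0 ix yn0.
    rewrite !metric_residualE !form_residualE Pl Ql.
    rewrite -[bil (a i x) y y]/(alpha2 a i x y) -alpha_sqr // -beta_dot.
    set s := beta b i x y / _ in p0 *.
    have -> : beta b i x y = s * alpha a i x y by rewrite /s divfK // gt_eqF.
    move=> h; have : (lam - c (crd_inv i x)) * (4 * alpha a i x y ^+ 2 * phi s) = 0.
      by rewrite -h; ring.
    move/eqP; rewrite mulf_eq0 subr_eq0 [X in _ || X]gt_eqF ?orbF => [/eqP//|].
    by rewrite !mulr_gt0 // exprn_gt0.
  move=> y; rewrite !metric_residualE !form_residualE Pl Ql lamE.
  by split; ring.
have n1 : \forall z \near x, img i z by exact: near_img.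
have n2 : \forall z \near x, dot (b i z) y0 != 0.
  exact: cb (open_nbhs_nbhs (conj (@open_neq R 0) by0)).
have n3 : \forall z \near x, D z != 0.
  exact: cD (open_nbhs_nbhs (conj (@open_neq R 0) Dx)).
near=> z; split; first by near: z.
- have : dot (b i z) y0 != 0 by near: z.
  by apply: contra_neq => ->; rewrite dot0l.
- have : D z != 0 by near: z.
  by move=> /eqP Dz /DP.
Unshelve. all: by end_near. Qed.

End Residual.

(** Multiplies the formula for phi by alpha. *)
Lemma exceptional_metric (U : set M) (N : R) :
  (forall i x y, ab_conic F i x y -> U (crd_inv i x) ->
     svalues I N (beta b i x y / alpha a i x y)) ->
  exceptional_profile I phi N ->
  riemannian_on F U \/
  exists psi, Theta psi /\ (metric_type_on F psi U \/ lorentz_type_on F psi U).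
Proof.
move=> sv [[C1 [C2 phi2]]|[psi [k1 [k2 [k3 [Tpsi k10 k30 typed]]]]]]; [left|right].
  move=> i x ix Ux; exists (C1 *: ((b i x)^T *m b i x) + C2 *: a i x) => y cy.
  rewrite -/(bil _ y y) bilDm !bilZm bil_outer -beta_dot.
  have [_ y0 _] := cy; have al0 := alpha_gt0 ix y0.
  rewrite -[bil (a i x) y y]/(alpha2 a i x y) -alpha_sqr // ab_F_homE exprMn.
  rewrite phi2; last exact: sv.
  by field; rewrite gt_eqF.
have rw : rewritten_on F psi k1 k2 k3 U.
  move=> i x y cy Ux /=; have [ix y0 _] := cy; have al0 := alpha_gt0 ix y0.
  have := typed _ (sv i x y cy Ux); rewrite -/a -/b ab_F_homE -alpha_sqr //=.
  set al := alpha a i x y in al0 *; set be := beta b i x y.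
  have aln : al != 0 by rewrite gt_eqF.
  have -> : k1 * al ^+ 2 + k2 * be ^+ 2 = al ^+ 2 * (k1 + k2 * (be / al) ^+ 2).
    by field.
  have -> : k3 * be = al * (k3 * (be / al)) by field.
  set q := k1 + _; move=> [q0 b0 ->].
  rewrite sqrtrM ?sqr_ge0 // sqrtr_sqr (gtr0_norm al0).
  split; [by rewrite mulr_gt0 ?exprn_gt0|exact: mulr_gt0|].
  by rewrite -mulf_div divff // mul1r -[RHS]mulrA.
exists psi; split => //.
have [k1n|k1p|k1e] := ltgtP k1 0; last by rewrite k1e eqxx in k10.
  by right; exists k1, k2, k3.
by left; exists k1, k2, k3.
Qed.

End ABMetric.

Theorem theorem1p1 (R : realType) (n : nat) (M : topologicalType)
    (A : atlas R n M) (F : ab_metric A) (V : vector_field A) (c : M -> R)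
    (n_ge2 : (1 < n)%N)
    (F_nonriemannian : nowhere F (riemannian_on F))
    (F_not_Theta : forall psi, Theta psi -> nowhere F (metric_type_on F psi))
    (F_not_lorentz : forall psi, Theta psi -> nowhere F (lorentz_type_on F psi)) :
  conformal_with V c F <->
  (forall (i : chart A) (x y : 'rV[R]_n), img i x ->
     complete_lift V (alpha2 (ab_a F)) i x y =
       4 * c (crd_inv i x) * alpha2 (ab_a F) i x y /\
     complete_lift V (beta (ab_b F)) i x y =
       2 * c (crd_inv i x) * beta (ab_b F) i x y).
Proof.
split=> [conf i x y ix|h]; last first.
  apply: conformal_of_residual_free => i x ix.
  by apply/residual_freeP => // y; exact: h.
apply: (residual_freeP F V c ix).1.
apply: (residual_free_of_neq0 conf) => // {ix y}{}i {}x ix b0.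
apply: contrapT => bad.
pose B := [set z | [/\ img i z, ab_b F i z != 0 & ~ residual_free F V c i z]].
have Wx : interior B x by exact: residual_neighborhood.
have [||z Wz|x2 [U [/interior_subset[i2 b2 bad2] Uo [x1 Ux1] UW Umax]]] :=
    @locally_near_maximum R _ (interior B)
      (fun z => dual_norm2 (ab_a F i z) (ab_b F i z)).
- exact: open_interior.
- by exists x.
- have [iz _ _] := interior_subset Wz.
  apply: continuous_dual_norm2; first exact: posdef_rm.
    by move=> k l; exact: continuous_on_img (rm_smooth _ i k l) iz.
  by move=> k l; rewrite (ord1 k); exact: continuous_on_img (of_smooth _ i l) iz.
(* F is exceptional over UM, with the formula for phi that holds at x2. *)
pose UM := chart_open i U.
have UMo : open UM by exact: open_chart_open.
have UM0 : UM !=set0.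
  have [[p ip px1] _ _] := interior_subset (UW _ Ux1).
  by exists p; split => //; rewrite px1.
have UMb : forall j z, img j z -> UM (crd_inv j z) -> ab_b F j z != 0.
  move=> j z jz /(chart_openP jz)[_ ov tr _ /UW/interior_subset[_ bz _]].
  by rewrite -tr; exact: one_form_neq0_transition ov bz.
have sv j z y : ab_conic F j z y -> UM (crd_inv j z) ->
    svalues (ab_dom F) (dual_norm2 (ab_a F i x2) (ab_b F i x2))
      (beta (ab_b F) j z y / alpha (ab_a F) j z y).
  move=> [jz y0 Is] /(chart_openP jz)[ov _ _ iz Uz]; split => //.
  have [_ bz _] := interior_subset (UW _ Uz).
  have al0 := alpha_gt0 F jz y0.
  rewrite exprMn exprVn ler_pdivrMr ?exprn_gt0 // alpha_sqr //.
  rewrite (beta_transition _ _ ov) (alpha2_transition _ _ ov).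
  apply: le_trans (beta_sqr_le (ab_a F) _ iz bz) _.
  apply: ler_wpM2r; last exact: Umax.
  by rewrite -alpha2_transition // ltW //; exact: rm_pos.
have [sol|//] := exceptional_or_residual_free n_ge2 conf i2 b2.
have [|[psi [/[dup] T1 T2 []]]] := exceptional_metric sv sol.
- exact: F_nonriemannian.2.
- exact: (F_not_Theta psi T1).2.
- exact: (F_not_lorentz psi T1).2.
Qed.
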